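(* Let $\Omega\subset\mathbb{R}^n$ be open and bounded, let $N\in\mathbb{N}$, $u^c=(u^c_1,\dots,u^c_N)\in L^2(\Omega;\mathbb{R}^N)$ and $u^\eta=(u^\eta_1,\dots,u^\eta_N)\in L^2(\Omega;\mathbb{R}^N)$. Let $\Lambda$ be a nonempty subset of a first countable topological space $X$, and for each $\lambda\in\Lambda$ let $\mathcal{R}_\lambda:L^2(\Omega)\to[0,\infty]$ be a weakly $L^2$-lower semicontinuous functional with $\{v\in L^2(\Omega):\mathcal{R}_\lambda(v)<\infty\}\neq\emptyset$. For $\lambda\in\Lambda$ and $j\in\{1,\dots,N\}$ set $$\mathcal{J}_{\lambda,j}(u)=\|u-u_j^\eta\|_{L^2(\Omega)}^2+\mathcal{R}_\lambda(u),\quad u\in L^2(\Omega),\qquad \mathcal{J}_\lambda=(\mathcal{J}_{\lambda,1},\dots,\mathcal{J}_{\lambda,N}).$$ If the family $\{\mathcal{J}_\lambda\}_{\lambda\in\Lambda}$ is weakly $L^2$-stable, then the functional $$\mathcal{I}:\Lambda\to[0,\infty),\qquad \mathcal{I}(\lambda)=\inf_{w\in K_\lambda}\|w-u^c\|^2_{L^2(\Omega;\mathbb{R}^N)},$$ where $K_\lambda=\{w\in L^2(\Omega;\mathbb{R}^N): w_j\in\operatorname{arg\,min}_{u\in L^2(\Omega)}\mathcal{J}_{\lambda,j}(u)\text{ for all }j\in\{1,\dots,N\}\}$, has a minimizer on $\Lambda$.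
   Context: Norm convention: $\|v\|^2_{L^2(\Omega;\mathbb{R}^N)}=\sum_{j=1}^N\|v_j\|^2_{L^2(\Omega)}$. Under the stated hypotheses each $\mathcal{J}_{\lambda,j}$ has a minimizer, so $K_\lambda\neq\emptyset$. $\Gamma$-convergence: for functionals $\mathcal{F}_k,\mathcal{F}:L^2(\Omega)\to[0,\infty]$, $\mathcal{F}=\Gamma(w\text{-}L^2)\text{-}\lim_{k\to\infty}\mathcal{F}_k$ (the sequence $\Gamma$-converges with respect to the weak $L^2$-topology) means: (liminf inequality) whenever $u_k\rightharpoonup u$ weakly in $L^2(\Omega)$, $\mathcal{F}(u)\le\liminf_{k\to\infty}\mathcal{F}_k(u_k)$; and (limsup inequality) for every $u\in L^2(\Omega)$ there is a sequence $u_k\rightharpoonup u$ weakly in $L^2(\Omega)$ with $\mathcal{F}(u)\ge\limsup_{k\to\infty}\mathcal{F}_k(u_k)$. Weak $L^2$-stability: the family $\{\mathcal{J}_\lambda\}_{\lambda\in\Lambda}$ is called weakly $L^2$-stable if for every sequence $(\lambda_k)_k\subset\Lambda$ such that $(\mathcal{J}_{\lambda_k,j})_k$ $\Gamma$-converges with respect to the weak $L^2$-topology for all $j\in\{1,\dots,N\}$, there exists $\lambda\in\Lambda$ such that $\Gamma(w\text{-}L^2)\text{-}\lim_{k\to\infty}\mathcal{J}_{\lambda_k,j}=\mathcal{J}_{\lambda,j}$ for all $j\in\{1,\dots,N\}$. *)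

(* Defs.v *)
From HB Require Import structures.
From mathcomp Require Import all_boot all_order all_algebra.
From mathcomp Require Import all_classical all_reals all_analysis.
From mathcomp Require Import measurable_realfun.

Set Implicit Arguments.
Unset Strict Implicit.
Unset Printing Implicit Defensive.
Import Order.TTheory GRing.Theory Num.Theory.
Import numFieldNormedType.Exports.
Local Open Scope classical_set_scope.
Local Open Scope ring_scope.

Section Rn.
Context {R : realType}.

(* 'rV[R]_n has no canonical sigma-algebra; this alias carries the Borel one. *)
Definition borelRn (n : nat) := g_sigma_algebraType (@open 'rV[R]_n).

Lemma open_measurable_Rn n (U : set 'rV[R]_n) :
  open U -> measurable (U : set (borelRn n)).
Proof. by move=> oU; exact: sub_sigma_algebra. Qed.

Lemma measurable_coord_Rn n (i : 'I_n) :
  measurable_fun [set: borelRn n] (fun x : borelRn n => (x : 'rV[R]_n) ord0 i).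
Proof.
apply: (measurability _ (RGenOpens.measurableE R)) => // _ [_ [a [b ->]] <-].
rewrite setTI; apply: open_measurable_Rn.
apply: (@open_comp 'rV[R]_n R (fun x => x ord0 i)); last exact: interval_open.
by move=> x _; exact: coord_continuous.
Qed.

Lemma measurable_fun_Rn d (T : measurableType d) n (f : T -> borelRn n) :
  (forall i, measurable_fun [set: T] (fun t => (f t : 'rV[R]_n) ord0 i)) ->
  measurable_fun [set: T] f.
Proof.
move=> mf.
apply: (@measurability _ _ _ _ setT f (@open 'rV[R]_n)) => //.
move=> _ [U oU <-]; rewrite setTI.
pose r k : R := k.+1%:R^-1.
have r0 k : 0 < r k by rewrite invr_gt0.
pose B (q : 'rV[rat]_n) k : set 'rV[R]_n := ball (map_mx ratr q : 'rV[R]_n) (r k).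
have mB q k : measurable (f @^-1` B q k).
  have -> : f @^-1` B q k =
      \bigcap_(i in [set: 'I_n])
        [set t | `|ratr (q ord0 i) - (f t : 'rV[R]_n) ord0 i| < r k].
    apply/seteqP; split => [t /= [_ h] i _|t h]; first by have := h ord0 i; rewrite mxE.
    by split=> // i j; rewrite !mxE (ord1 i); exact: h.
  apply: fin_bigcap_measurable => // i _.
  rewrite (_ : [set _ | _] = (fun t => `|ratr (q ord0 i) - (f t : 'rV[R]_n) ord0 i|)
     @^-1` [set x | x < r k])//.
  rewrite -[X in measurable X]setTI.
  have mg : measurable_fun setT
      (fun t => `|ratr (q ord0 i) - (f t : 'rV[R]_n) ord0 i| : R).
    by apply: measurableT_comp => //; exact: measurable_funB.
  apply: mg => //.
  by rewrite (_ : [set x | _] = `]-oo, (r k)[%classic) //; apply/seteqP; split => x;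
    rewrite /= in_itv.
have -> : f @^-1` U =
    \bigcup_(p : 'rV[rat]_n * nat)
       (if `[< B p.1 p.2 `<=` U >] then f @^-1` B p.1 p.2 else set0).
  apply/seteqP; split => [t Ut|t [p _]]; last first.
    by case: asboolP => // BU /BU.
  have /nbhs_ballP[e/= e0 eU] : nbhs (f t : 'rV[R]_n) U by exact: open_nbhs_nbhs.
  have [k ke] : exists k, r k < e / 2.
    have [k _ hk] := near_infty_natSinv_lt (PosNum (divr_gt0 e0 (ltr0n R 2))).
    by exists k; exact: (hk k (leqnn k)).
  have q_ i : {q : rat | `|ratr q - (f t : 'rV[R]_n) ord0 i| < r k}.
    apply: cid; set x := (f t : 'rV[R]_n) ord0 i.
    have /rat_in_itvoo[q] : x - r k < x + r k.
      by rewrite ltrD2l (lt_trans _ (r0 k))// oppr_lt0.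
    by rewrite in_itv /= => hq; exists q; rewrite distrC ltr_distlC.
  exists (\row_i sval (q_ i), k) => //=.
  case: asboolP => [_|].
    split => // i j; rewrite !mxE (ord1 i); exact: (svalP (q_ j)).
  case => y [_ By]; apply: eU; split => // i j.
  have := By i j; have := svalP (q_ j); rewrite !mxE (ord1 i) /ball /=.
  rewrite /ball_ /= => h1 h2.
  rewrite (le_lt_trans (ler_distD (ratr (sval (q_ j))) _ _))//.
  by rewrite (splitr e) ltrD// ?(distrC _ (ratr _)) (lt_trans _ ke).
apply: countable_bigcupT_measurable; first exact: countableP.
by move=> p; case: ifP.
Qed.

(* ((x_1, ..., x_n), y) |-> (y, x_1, ..., x_n) *)
Definition consRn n (p : borelRn n * measurableTypeR R) : borelRn n.+1 :=
  row_mx (p.2%:M : 'rV[R]_1) (p.1 : 'rV[R]_n).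

Lemma consRn0 n (p : borelRn n * measurableTypeR R) :
  (consRn p : 'rV[R]_n.+1) ord0 ord0 = p.2.
Proof.
have -> : ord0 = lshift n (ord0 : 'I_1) :> 'I_n.+1 by exact: val_inj.
by rewrite [LHS](row_mxEl (p.2%:M : 'rV[R]_1)) mxE eqxx mulr1n.
Qed.

Lemma consRnS n (p : borelRn n * measurableTypeR R) (i : 'I_n) :
  (consRn p : 'rV[R]_n.+1) ord0 (lift ord0 i) = (p.1 : 'rV[R]_n) ord0 i.
Proof.
have -> : lift ord0 i = rshift 1 i :> 'I_n.+1 by exact: val_inj.
exact: (row_mxEr (p.2%:M : 'rV[R]_1)).
Qed.

Lemma measurable_consRn n : measurable_fun [set: _] (@consRn n).
Proof.
apply: measurable_fun_Rn => i; case: (unliftP ord0 i) => [j|] ->.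
  under eq_fun do rewrite consRnS.
  exact: (measurableT_comp (measurable_coord_Rn j) measurable_fst).
by under eq_fun do rewrite consRn0; exact: measurable_snd.
Qed.

Definition lebesgue_step n (m : {measure set (borelRn n) -> \bar R}) :
    {measure set (borelRn n.+1) -> \bar R} :=
  measure_function_pushforward__canonical__measure_function_Measure
    (m \x (@lebesgue_measure R))%E (@measurable_consRn n).

(* n-fold product of the Lebesgue measure on R *)
Fixpoint lebesgueRn (n : nat) : {measure set (borelRn n) -> \bar R} :=
  match n with
  | 0 => \d_((0 : 'rV[R]_0) : borelRn 0)
  | n'.+1 => lebesgue_step (lebesgueRn n')
  end.

Lemma lebesgueRn_box n (a b : 'I_n -> R) : (forall i, a i <= b i) ->
  lebesgueRn n [set x : 'rV[R]_n | forall i, a i <= x ord0 i <= b i] =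
  (\prod_i (b i - a i))%:E.
Proof.
elim: n a b => [|n IH] a b ab.
  by rewrite big_ord0 /= diracE mem_set// => -[].
rewrite big_ord_recl mulrC EFinM /= /lebesgue_step /pushforward.
rewrite (_ : _ @^-1` _ =
    [set x : 'rV[R]_n | forall i, a (lift ord0 i) <= x ord0 i <= b (lift ord0 i)]
    `*` `[a ord0, b ord0]%classic); last first.
  apply/seteqP; split => [[x y] h|[x y] [h h0] i] /=.
    split => /= [i|]; rewrite ?in_itv /=.
      by have := h (lift ord0 i); rewrite consRnS.
    by have := h ord0; rewrite consRn0.
  case: (unliftP ord0 i) => [j|] ->; first by rewrite consRnS; exact: h.
  by move: h0; rewrite /= in_itv /= consRn0.
rewrite product_measure1E//.
- rewrite IH//; congr (_ * _)%E.
  rewrite [LHS](lebesgue_measure_itv `[a ord0, b ord0]).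
  rewrite /= lte_fin; have [//|ba|->] := ltgtP (a ord0) (b ord0).
    by have := ab ord0; rewrite leNgt ba.
  by rewrite subrr.
- rewrite (_ : [set x | _] = \bigcap_(i in [set: 'I_n])
     ((fun x : borelRn n => (x : 'rV[R]_n) ord0 i) @^-1`
       `[a (lift ord0 i), b (lift ord0 i)]%classic)); last first.
    by apply/seteqP; split => x /= h i => [_|]; have := h i; rewrite /= in_itv//=;
      apply.
  apply: fin_bigcap_measurable => // i _.
  by rewrite -[X in measurable X]setTI; exact: measurable_coord_Rn.
Qed.

(* L2 classes for this measure are the elements of L^2(Omega): values outside
   Omega are irrelevant since the complement of Omega is negligible. *)
Definition lebesgue_on n (Omega : set 'rV[R]_n) (oO : open Omega) :
    {measure set (borelRn n) -> \bar R} :=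
  mrestr (lebesgueRn n) (open_measurable_Rn oO).

End Rn.

Definition first_countable (X : topologicalType) :=
  forall x : X, exists B : set (set X), [/\ countable B,
    B `<=` nbhs x & forall V, nbhs x V -> exists2 U, B U & U `<=` V].

Section L2.
Context d (T : measurableType d) (R : realType) (mu : {measure set T -> \bar R}).
Local Notation L2 := (LspaceType2 mu).
Implicit Types (u v : L2) (F : L2 -> \bar R).

(* An element of LspaceType2 mu is an almost-everywhere class; u x is the value
   at x of some fixed representative, on which the integrals do not depend. *)
Definition L2dist2 u v : \bar R := ('N[mu]_2%:E [(fun x => (u x - v x)%:E)] ^+ 2)%E.

(* elements of L^2(Omega; R^N) are given by their N components *)
Definition L2Ndist2 N (w v : 'I_N -> L2) : \bar R :=
  (\sum_(j < N) L2dist2 (w j) (v j))%E.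

(* Pairing with L^2 gives the whole dual, by Riesz representation. *)
Definition weak_cvg (u_ : nat -> L2) (u : L2) :=
  forall g : L2,
    (\int[mu]_x (u_ k x * g x))%R @[k --> \oo] --> (\int[mu]_x (u x * g x))%R.

(* Lower semicontinuity is sequential, as is Gamma-convergence below; this is
   implied by lower semicontinuity for the weak topology. *)
Definition weak_lsc F := forall (u_ : nat -> L2) (u : L2),
  weak_cvg u_ u -> (F u <= limn_einf (fun k => F (u_ k)))%E.

Definition Gamma_lim (F_ : nat -> L2 -> \bar R) F :=
  (forall (u_ : nat -> L2) (u : L2),
     weak_cvg u_ u -> (F u <= limn_einf (fun k => F_ k (u_ k)))%E) /\
  (forall u : L2, exists2 u_ : nat -> L2,
     weak_cvg u_ u & (limn_esup (fun k => F_ k (u_ k)) <= F u)%E).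

Definition Gamma_converges (F_ : nat -> L2 -> \bar R) :=
  exists2 F : L2 -> \bar R, (forall u, 0 <= F u)%E & Gamma_lim F_ F.

Definition weakly_stable (X : Type) (Lam : set X) N
    (J : X -> 'I_N -> L2 -> \bar R) :=
  forall lam_ : nat -> X, (forall k, Lam (lam_ k)) ->
    (forall j, Gamma_converges (fun k => J (lam_ k) j)) ->
  exists2 lam, Lam lam & forall j, Gamma_lim (fun k => J (lam_ k) j) (J lam j).

Definition argmin F : set L2 := [set u | forall v, (F u <= F v)%E].

Definition denoising (X : Type) N (ueta : 'I_N -> L2) (Reg : X -> L2 -> \bar R)
    (lam : X) (j : 'I_N) (u : L2) : \bar R :=
  (L2dist2 u (ueta j) + Reg lam u)%E.

Definition reconstructions (X : Type) N (J : X -> 'I_N -> L2 -> \bar R) (lam : X) :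
    set ('I_N -> L2) :=
  [set w | forall j, argmin (J lam j) (w j)].

Definition upper_level (X : Type) N (uc : 'I_N -> L2)
    (J : X -> 'I_N -> L2 -> \bar R) (lam : X) : \bar R :=
  ereal_inf [set L2Ndist2 w uc | w in reconstructions J lam].

End L2.

(* Main.v *)
Require Import Defs.
From HB Require Import structures.
From mathcomp Require Import all_boot all_order all_algebra.
From mathcomp Require Import all_classical all_reals all_analysis.
From mathcomp Require Import measurable_realfun.
From mathcomp Require Import ring lra.

Set Implicit Arguments.
Unset Strict Implicit.
Unset Printing Implicit Defensive.
Import Order.TTheory GRing.Theory Num.Theory.
Import numFieldNormedType.Exports HBNNSimple.
Local Open Scope classical_set_scope.
Local Open Scope ring_scope.

(** The proof is the direct method of the calculus of variations, carried out
    for sequences. Let m be the infimum of the upper-level functional on Lam,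
    and take lam_k in Lam and w_k in K_(lam_k) with |w_k - uc|^2 tending to m.
    The w_k are bounded, so along a subsequence they converge weakly to some w
    ([L2_weak_compact]). Every lower-level functional dominates the squared
    distance to its datum, so a further subsequence of them Gamma-converges,
    for all components at once ([Gamma_compact]). Stability identifies the
    Gamma-limits as the lower-level functionals of one parameter lam0 of Lam.
    Weak limits of minimizers minimize the Gamma-limit ([Gamma_lim_argmin]), so
    w is in K_(lam0), and weak lower semicontinuity of the norm ([tangent_le],
    [tangent_cvg]) gives |w - uc|^2 <= m. The same compactness shows that every
    K_lam is nonempty ([argmin_fidelity]), hence that the functional is finite.

    Weak compactness is obtained by representing limits of pairings. A bounded
    linear form on L^2 of a finite measure sends indicators of sets to the
    values of an absolutely continuous charge; its Radon-Nikodym density lies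
    in L^2 and represents the form ([L2_Riesz]). On a bounded sequence, weak
    convergence only has to be tested on the indicators of a countable
    pi-system generating the sigma-algebra ([pairing_cvg0]): the sets that pass
    the test form a lambda-system, and indicators are total in L^2. Hence a
    diagonal extraction suffices for weak compactness.

    The same countable family of tests makes the weak topology second countable
    on bounded sets. Extracting a subsequence along which the infima of the
    functionals over all basic neighbourhoods converge, the Gamma-limit at u is
    the supremum, over the basic neighbourhoods of u, of the limits of these
    infima. For Omega the pi-system consists of the finite intersections of
    balls with rational centres. *)

(** * Subsequences and lower and upper limits *)

Section Subsequences.
Context {R : realType}.

Lemma increasing_seq_ge (s : nat -> nat) : increasing_seq s ->
  forall n, (n <= s n)%N.
Proof.
move=> /increasing_seqP si; elim=> // n IH.
by apply: leq_ltn_trans IH _; exact: si.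
Qed.

Lemma increasing_seq_cvg (s : nat -> nat) : increasing_seq s -> s @ \oo --> \oo.
Proof.
move=> si A [N _ NA]; exists N => // n /= Nn; apply: NA => /=.
exact: leq_trans (increasing_seq_ge si n).
Qed.

Lemma increasing_seq_comp (s t : nat -> nat) :
  increasing_seq s -> increasing_seq t -> increasing_seq (s \o t).
Proof. by move=> si ti m n; rewrite /= si -leEnat ti. Qed.

(** Cantor's diagonal: extract successively for each index; from rank i on, the
    diagonal is a subsequence of the i-th extraction. *)
Lemma diagonal_subsequence (a : nat -> nat -> R) :
  (forall i, bounded_fun (a i)) ->
  exists2 s, increasing_seq s & forall i, cvgn (a i \o s).
Proof.
move=> ba.
have step (i : nat) (s : nat -> nat) :
    {t | increasing_seq t /\ cvgn (a i \o s \o t)}.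
  have bs : bounded_fun (a i \o s).
    have [M [Mr hM]] := ba i.
    by exists M; split => // x Mx y _; exact: hM.
  by apply: cid; have [t ti ct] := bolzano_weierstrass bs; exists t.
pose sig := fix sig i := if i is j.+1 then sig j \o sval (step j (sig j)) else id.
have sigi i : increasing_seq (sig i).
  elim: i => [//|i IH] /=; apply: increasing_seq_comp => //.
  by case: (step _ _) => t [].
have sigc i : cvgn (a i \o sig i.+1) by rewrite /=; case: (step _ _) => t [].
have sigm i j k : exists2 m, (k <= m)%N & sig (i + j)%N k = sig i m.
  elim: j k => [|j IH] k; first by rewrite addn0; exists k.
  rewrite addnS /=; case: (step _ _) => t [ti _] /=.
  have [m km ->] := IH (t k); exists m => //.
  exact: leq_trans (increasing_seq_ge ti k) km.
exists (fun k => sig k.+1 k).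
  apply/increasing_seqP => n.
  have lt_sig m : (n < m)%N -> (sig n.+1 n < sig n.+1 m)%N.
    by move=> nm; have := leW_mono (sigi n.+1) n m; rewrite !ltEnat /= => ->.
  apply: lt_sig.
  exact: (increasing_seq_ge (svalP (step n.+1 (sig n.+1))).1 n.+1).
move=> i; apply/cvg_ex; exists (limn (a i \o sig i.+1)).
move=> A /sigc[N _ NA]; exists (maxn N i) => // k /=; rewrite geq_max => /andP[Nk ik].
have := sigm i.+1 (k - i)%N k; rewrite addSn subnKC // => -[m km E].
change (A (a i (sig k.+1 k))); rewrite E.
by apply: NA => /=; exact: leq_trans km.
Qed.

Lemma bounded_subsequence (I : countType) (a : I -> nat -> R) :
  (forall i, bounded_fun (a i)) ->
  exists2 s, increasing_seq s & forall i, cvgn (a i \o s).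
Proof.
move=> ba; pose b n := if unpickle n is Some i then a i else cst 0.
have bb n : bounded_fun (b n).
  rewrite /b; case: unpickle => // .
  by exists 0; split => // x x0 y _ /=; rewrite normr0 ltW.
have [s si cs] := diagonal_subsequence bb; exists s => // i.
by have := cs (pickle i); rewrite /b pickleK.
Qed.

(** Through [contract], the extended real line is homeomorphic to a compact
    interval, where bounded sequences can be extracted from. *)
Lemma ereal_subsequence (I : countType) (a : I -> nat -> \bar R) :
  exists2 s, increasing_seq s & forall i, cvgn (a i \o s).
Proof.
have ba i : bounded_fun (fun k => contract (a i k)).
  exists 1; split => // x x1 y _ /=; apply: le_trans (ltW x1).
  exact: contract_le1.
have [s si cs] := bounded_subsequence ba; exists s => // i.
apply/cvg_ex; have /cvg_ex[c cc] := cs i; exists (expand c).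
have c1 : `|c| <= 1.
  rewrite -(cvg_lim (@norm_hausdorff _ _) (cvg_norm cc)).
  apply: limr_le; first by apply/cvg_ex; exists `|c|; exact: cvg_norm.
  by apply: nearW => k /=; exact: contract_le1.
apply/cvg_ballP => e e0; have /cvgrPdist_lt := cc => /(_ e e0).
apply: filterS => k /=; rewrite /ball /= /ereal_ball expandK//.
Qed.

End Subsequences.

Section LimInfSup.
Context {R : realType}.
Implicit Types (a b : nat -> \bar R) (c : \bar R).
Local Open Scope ereal_scope.

Lemma limn_esup_le c b : (\forall k \near \oo, b k <= c) -> limn_esup b <= c.
Proof.
move=> [N _ cb]; rewrite limn_esup_lim; apply: lime_le; first exact: is_cvg_esups.
exists N => // n /= Nn; apply: ge_ereal_sup => _ [m /= nm <-].
by apply: cb => /=; exact: leq_trans nm.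
Qed.

Lemma le_limn_einf_cvg a b c : (\forall k \near \oo, a k <= b k) ->
  a @ \oo --> c -> c <= limn_einf b.
Proof.
move=> ab ac; rewrite leNgt; apply/negP => bc.
suff : limn_einf a <= limn_einf b.
  by rewrite (cvg_limn_einf_sup ac).1 leNgt bc.
case: ab => N _ ab; rewrite !limn_einf_lim.
apply: lee_lim; [exact: is_cvg_einfs|exact: is_cvg_einfs|].
exists N => // n /= Nn; apply: le_ereal_inf_tmp => _ [m /= nm <-].
apply: le_trans (ab m _) => /=; last exact: leq_trans nm.
by apply: ereal_inf_lbound; exists m.
Qed.

Lemma limn_esup_le_cvg_near a b c : (\forall k \near \oo, b k <= a k) ->
  a @ \oo --> c -> limn_esup b <= c.
Proof.
move=> ba ac; rewrite -(cvg_limn_einf_sup ac).2; case: ba => N _ ba.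
rewrite !limn_esup_lim.
apply: lee_lim; [exact: is_cvg_esups|exact: is_cvg_esups|].
exists N => // n /= Nn; apply: ge_ereal_sup => _ [m /= nm <-].
apply: le_trans (ba m _) _ => /=; first exact: leq_trans nm.
by apply: ereal_sup_ubound; exists m.
Qed.

End LimInfSup.

(** If for each p a witness exists for all large k, the precision p can be
    made to tend to infinity with k: at stage k, use the largest p <= k that has
    a witness. The default x0 is used at the early stages without any witness;
    recording this makes the whole sequence, and not only its tail,
    controllable. *)
Lemma diagonal_selection (S : Type) (x0 : S) (Q : nat -> nat -> S -> Prop) :
  (forall p, \forall k \near \oo, exists x, Q p k x) ->
  exists (phi : nat -> nat) (x_ : nat -> S), [/\ phi @ \oo --> \oo,
    \forall k \near \oo, Q (phi k) k (x_ k) &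
    forall k, Q (phi k) k (x_ k) \/ x_ k = x0].
Proof.
move=> QK.
have max_ex k : exists m, (exists2 p, (p <= k)%N & exists x, Q p k x) ->
    (exists x, Q m k x) /\ forall p, (p <= k)%N -> (exists x, Q p k x) -> (p <= m)%N.
  have [[p pk Qp]|nQ] := pselect (exists2 p, (p <= k)%N & exists x, Q p k x); last first.
    by exists 0%N.
  pose B := fun p => (p <= k)%N && `[< exists x, Q p k x >].
  have exB : exists p, B p by exists p; rewrite /B pk; apply/asboolP.
  have ubB p' : B p' -> (p' <= k)%N by case/andP.
  have [m /andP[mk /asboolP Qm] mmax] := ex_maxnP exB ubB.
  exists m => _; split => // p' p'k Qp'; apply: mmax.
  by rewrite /B p'k; apply/asboolP.
have [phi phiP] := choice max_ex.
have x_ex k : exists x, ((exists y, Q (phi k) k y) -> Q (phi k) k x) /\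
    (Q (phi k) k x \/ x = x0).
  have [[y Qy]|nQ] := pselect (exists y, Q (phi k) k y).
    by exists y; split => //; left.
  by exists x0; split => [//|]; right.
have [x_ xP] := choice x_ex.
exists phi, x_; split.
- move=> P [N _ NP]; have [K _ KN] := QK N.
  exists (maxn N K) => // k /=; rewrite geq_max => /andP[Nk Kk].
  have QN := KN k Kk; apply: NP => /=.
  by apply: (phiP k _).2 => //; exists N.
- have [K _ K0] := QK 0%N; exists K => // k Kk.
  by apply: (xP k).1; apply: (phiP k _).1; exists 0%N => //; exact: K0.
- by move=> k; exact: (xP k).2.
Qed.

(** * The scalar product of L^2 *)

Section L2pairing.
Context d (T : measurableType d) (R : realType) (mu : {measure set T -> \bar R}).
Implicit Types f g h : T -> R.
Local Notation L2f := (Lfun mu 2%:E).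

Definition L2pairing f g : R := \int[mu]_x (f x * g x).
Local Notation pairing := L2pairing.

Lemma Lspace2_Lfun (u : LspaceType2 mu) : (u : T -> R) \in L2f.
Proof.
rewrite inE; apply/andP; split; rewrite inE /=.
  rewrite /aqEqMfun_to_fun; exact: (@measurable_funPT _ _ _ _ (repr (LebesgueSpace.sort u))).
exact: (@Lebesgue_finite _ _ _ _ _ _ u).
Qed.

Lemma measurable_Lfun2 f : f \in L2f -> measurable_fun setT f.
Proof. by rewrite inE => /andP[/set_mem]. Qed.

Lemma integrable_mul f g : f \in L2f -> g \in L2f ->
  mu.-integrable setT (EFin \o (fun x => f x * g x)).
Proof.
by move=> f2 g2; have /Lfun1_integrable := Lfun2_mul_Lfun1 f2 g2.
Qed.

Lemma integrable_mul_indic f (A : set T) : mu.-integrable setT (EFin \o f) ->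
  measurable A -> mu.-integrable setT (EFin \o (fun x => f x * \1_A x)).
Proof.
move=> fi mA; apply: le_integrable (fi) => //.
  have /measurable_EFinP mf := measurable_int mu fi.
  by apply/measurable_EFinP; exact: measurable_funM.
move=> x _; rewrite /= lee_fin indicE; case: (_ \in _); rewrite ?mulr1// mulr0.
by rewrite normr0.
Qed.

Lemma sqr_integrable_Lfun2 f : measurable_fun setT f ->
  (\int[mu]_x (f x ^+ 2)%:E < +oo)%E -> f \in L2f.
Proof.
move=> mf fy; rewrite inE; apply/andP; split; rewrite inE //=.
rewrite /finite_norm unlock poweR_lty//.
by under eq_integral do rewrite /= powR_mulrn// -normrX ger0_norm ?sqr_ge0//.
Qed.

Lemma Lfun2_le f g : measurable_fun setT f -> g \in L2f ->
  (forall x, `|f x| <= `|g x|) -> f \in L2f.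
Proof.
move=> mf g2 fg; apply: sqr_integrable_Lfun2 => //.
have /integrable_lty := Lfun2_integrable_sqr g2; move=> /(_ measurableT).
apply: le_lt_trans; apply: ge0_le_integral => //.
- by move=> x _; rewrite lee_fin sqr_ge0.
- by apply/measurable_EFinP; exact: measurable_funX.
- by apply/measurable_EFinP; apply: measurable_funX; exact: measurable_Lfun2 g2.
- move=> x _; rewrite lee_fin -(ger0_norm (sqr_ge0 (f x))).
  by rewrite -(ger0_norm (sqr_ge0 (g x))) !normrX lerXn2r ?nnegrE.
Qed.

Lemma Lfun_Lspace2 f : f \in L2f ->
  exists v : LspaceType2 mu, {ae mu, forall x, v x = f x}.
Proof.
move=> f2; have mf := measurable_Lfun2 f2.
pose F : {mfun T >-> measurableTypeR R} :=
  HB.pack f (@isMeasurableFun.Build _ _ T (measurableTypeR R) f mf).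
pose q : {mfun_ mu, T >-> measurableTypeR R} :=
  (\pi_({mfun_ mu, T >-> measurableTypeR R}) F)%qT.
have qf : {ae mu, forall x, (q : T -> R) x = f x}.
  have /eqmodP/asboolP := reprK q.
  by apply: filterS => x /(_ I).
have mq : measurable_fun setT (q : T -> R).
  exact: (@measurable_funPT _ _ _ _ (repr q)).
have q2 : (q : T -> R) \in L2f.
  apply: sqr_integrable_Lfun2 => //.
  rewrite (ae_eq_integral (fun x => (f x ^+ 2)%:E)) //.
  - by have /integrable_lty := Lfun2_integrable_sqr f2; exact.
  - by apply/measurable_EFinP; exact: measurable_funX.
  - by apply/measurable_EFinP; exact: measurable_funX.
  - by apply: filterS qf => x /= -> _.
have nq : finite_norm mu 2%:E (q : T -> R).
  by move: q2; rewrite inE => /andP[_ /set_mem].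
pose v : LspaceType2 mu :=
  HB.pack q (@isFinLebesgue.Build d T R mu 2%:E (lee1n 2) q nq).
by exists v.
Qed.

Lemma EFin_pairing f g : f \in L2f -> g \in L2f ->
  (pairing f g)%:E = (\int[mu]_x (f x * g x)%:E)%E.
Proof.
move=> f2 g2; rewrite /L2pairing /Rintegral fineK//.
by apply: integrable_fin_num => //; exact: integrable_mul.
Qed.

Lemma pairing_ae f g h : f \in L2f -> g \in L2f -> h \in L2f ->
  {ae mu, forall x, f x = g x} -> pairing f h = pairing g h.
Proof.
move=> f2 g2 h2 fg; rewrite /L2pairing /Rintegral; congr fine.
apply: ae_eq_integral => //.
- by have /integrableP[] := integrable_mul f2 h2.
- by have /integrableP[] := integrable_mul g2 h2.
- by apply: filterS fg => x /= -> _.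
Qed.

Lemma pairing_ge0 f : 0 <= pairing f f.
Proof. by apply: Rintegral_ge0 => x _; rewrite -expr2; exact: sqr_ge0. Qed.

Lemma Lnorm2_pairing f : f \in L2f ->
  ('N[mu]_2%:E[(fun x => (f x)%:E)] ^+ 2)%E = (pairing f f)%:E.
Proof.
move=> f2; rewrite EFin_pairing// unlock.
under eq_integral => x _.
  rewrite /= powR_mulrn// -normrX ger0_norm ?sqr_ge0// expr2; over.
rewrite -EFin_pairing//= powR12_sqrt ?pairing_ge0//.
by rewrite -EFinM -expr2 sqr_sqrtr ?pairing_ge0.
Qed.

Lemma pairingC f g : pairing f g = pairing g f.
Proof. by apply: eq_Rintegral => x _; rewrite mulrC. Qed.

Lemma pairingDl f g h : f \in L2f -> g \in L2f -> h \in L2f ->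
  pairing (f \+ g) h = pairing f h + pairing g h.
Proof.
move=> f2 g2 h2; rewrite -RintegralD//; [|exact: integrable_mul..].
by apply: eq_Rintegral => x _; rewrite mulrDl.
Qed.

Lemma pairingBl f g h : f \in L2f -> g \in L2f -> h \in L2f ->
  pairing (f \- g) h = pairing f h - pairing g h.
Proof.
move=> f2 g2 h2; rewrite -RintegralB//; [|exact: integrable_mul..].
by apply: eq_Rintegral => x _; rewrite mulrBl.
Qed.

Lemma pairingZl k f h : f \in L2f -> h \in L2f ->
  pairing (fun x => k * f x) h = k * pairing f h.
Proof.
move=> f2 h2; rewrite -RintegralZl//; last exact: integrable_mul.
by apply: eq_Rintegral => x _; rewrite mulrA.
Qed.

Lemma Lfun2_lin k f g : f \in L2f -> g \in L2f ->
  (fun x => k * f x + g x) \in L2f.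
Proof. exact: (Lfun_submod_closed mu (lee1n 2)).2. Qed.

Lemma Lfun2D f g : f \in L2f -> g \in L2f -> f \+ g \in L2f.
Proof.
move=> f2 g2; have := Lfun2_lin 1 f2 g2.
by under eq_fun do rewrite mul1r.
Qed.

Lemma Lfun2B f g : f \in L2f -> g \in L2f -> f \- g \in L2f.
Proof.
move=> f2 g2; have := Lfun2_lin (- 1) g2 f2.
by under eq_fun do rewrite mulN1r addrC.
Qed.

Lemma Lfun2_0 : (fun=> 0) \in L2f.
Proof. exact: (Lfun_submod_closed mu (lee1n 2)).1. Qed.

Lemma Lfun2Z k f : f \in L2f -> (fun x => k * f x) \in L2f.
Proof.
move=> f2; have := Lfun2_lin k f2 Lfun2_0.
by under eq_fun do rewrite addr0.
Qed.

(** The quadratic polynomial t |-> |f - t g|^2 is nonnegative; it is evaluated at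
    its vertex, or far away when it is affine. *)
Lemma pairing_CauchySchwarz f g : f \in L2f -> g \in L2f ->
  pairing f g ^+ 2 <= pairing f f * pairing g g.
Proof.
move=> f2 g2.
have quad t : 0 <= pairing f f - 2 * t * pairing f g + t ^+ 2 * pairing g g.
  have tg2 := Lfun2Z t g2; have h2 := Lfun2B f2 tg2.
  have := pairing_ge0 (f \- (fun x => t * g x)).
  rewrite pairingBl// (pairingC f) (pairingC (fun x => t * g x)).
  rewrite !pairingBl// !pairingZl// (pairingC f (fun x => t * g x)).
  rewrite (pairingC g (fun x => t * g x)) !pairingZl// (pairingC g f).
  by move=> h; lra.
have [g0|gn0] := eqVneq (pairing g g) 0.
  rewrite g0 mulr0; have [-> | b0] := eqVneq (pairing f g) 0.
    by rewrite expr0n.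
  have := quad ((pairing f f + 1) / (2 * pairing f g)).
  rewrite g0 mulr0 addr0.
  have -> : 2 * ((pairing f f + 1) / (2 * pairing f g)) * pairing f g =
      pairing f f + 1 by field.
  by move=> h; lra.
have gp : 0 < pairing g g by rewrite lt_def gn0 pairing_ge0.
have := quad (pairing f g / pairing g g).
rewrite -(pmulr_lge0 _ gp) => q; rewrite -subr_ge0; apply: le_trans q _.
by rewrite le_eqVlt; apply/orP; left; apply/eqP; field.
Qed.

(** Parallelogram law, with the term |f + g|^2 dropped. *)
Lemma pairingB_le f g : f \in L2f -> g \in L2f ->
  pairing (f \- g) (f \- g) <= 2 * pairing f f + 2 * pairing g g.
Proof.
move=> f2 g2; have fg2 := Lfun2B f2 g2; have fD2 := Lfun2D f2 g2.
have := pairing_ge0 (f \+ g).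
rewrite (pairingDl f2 g2 fD2) (pairingBl f2 g2 fg2).
rewrite (pairingC f (_ \+ _)) (pairingC g (_ \+ _)).
rewrite (pairingC f (_ \- _)) (pairingC g (_ \- _)).
rewrite !pairingBl// !(pairingDl f2 g2)// (pairingC g f).
by move=> h; lra.
Qed.

End L2pairing.

(** * Simple functions and convergence in L^2 *)

Section SimpleApproximation.
Context d (T : measurableType d) (R : realType).

Lemma nnsfun_rect_indic (P : (T -> R) -> Prop) :
  P (fun=> 0) ->
  (forall k (A : set T) f, measurable A -> P f ->
     P (fun x => k * \1_A x + f x)) ->
  forall s : {nnsfun T >-> R}, P s.
Proof.
move=> P0 PD s.
have Ps (r : seq R) : P (fun x => \sum_(y <- r) y * \1_(s @^-1` [set y]) x).
  elim: r => [|y r IH]; first by under eq_fun do rewrite big_nil.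
  under eq_fun do rewrite big_cons.
  by apply: PD => //; exact: measurable_sfunP.
have := Ps (finmap.enum_fset (fset_set (range s))).
by congr P; apply/funext => x; rewrite fimfunE fsbig_finite.
Qed.

Lemma nnsfun_below (g : T -> R) : measurable_fun setT g -> (forall x, 0 <= g x) ->
  exists s : nat -> {nnsfun T >-> R},
    [/\ forall m n x, (m <= n)%N -> s m x <= s n x, forall n x, s n x <= g x &
        forall x, s n x @[n --> \oo] --> g x].
Proof.
move=> mg g0; have mg' : measurable_fun setT (EFin \o g) by exact/measurable_EFinP.
pose s := nnsfun_approx measurableT mg'.
have s_nd m n x : (m <= n)%N -> s m x <= s n x.
  by move=> mn; have /lefP := nd_nnsfun_approx measurableT mg' mn; exact.
have s_cvg x : s n x @[n --> \oo] --> g x.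
  have sE : EFin \o s^~ x @ \oo --> (g x)%:E.
    by apply: (cvg_nnsfun_approx measurableT mg') => // y _; rewrite lee_fin.
  exact: (fine_cvg sE).
exists s; split => // n x.
rewrite -(cvg_lim (@Rhausdorff R) (s_cvg x)).
apply: limr_ge; first by apply/cvg_ex; exists (g x).
by exists n => // m /= nm; exact: s_nd.
Qed.

End SimpleApproximation.

Section L2convergence.
Context d (T : measurableType d) (R : realType) (mu : {measure set T -> \bar R}).
Implicit Types f g h : T -> R.
Local Notation L2f := (Lfun mu 2%:E).
Local Notation pairing := (L2pairing mu).

Lemma Lfun2_dominated_cvg (g_ : nat -> T -> R) g h :
  (forall n, g_ n \in L2f) -> g \in L2f -> h \in L2f ->
  (forall n x, `|g x - g_ n x| <= h x) ->
  (forall x, g_ n x @[n --> \oo] --> g x) ->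
  pairing (g \- g_ n) (g \- g_ n) @[n --> \oo] --> 0.
Proof.
move=> gn2 g2 h2 gh gc.
pose r n x := (g x - g_ n x) * (g x - g_ n x).
have mr n : measurable_fun setT (EFin \o r n).
  have mB : measurable_fun setT (fun x => g x - g_ n x).
    by apply: measurable_funB; apply: measurable_Lfun2; [exact: g2|exact: gn2].
  by apply/measurable_EFinP; exact: measurable_funM.
have [_ _] : [/\ mu.-integrable setT (cst 0%E : T -> \bar R),
    [sequence (\int[mu]_x `|(EFin \o r n) x - cst 0 x|)%E]_n @ \oo --> 0%E &
    [sequence (\int[mu]_x (EFin \o r n) x)%E]_n @ \oo --> (\int[mu]_x cst 0 x)%E].
  apply: (@dominated_convergence _ _ _ mu setT measurableT _ _
    (EFin \o (fun x => h x * h x))) => //.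
  - apply: aeW => x _ /=; apply: cvg_EFin; first exact: nearW.
    rewrite /comp /= /r -[X in _ --> X](mulr0 0) -(subrr (g x)).
    by apply: cvgM; apply: cvgB => //; exact: cvg_cst.
  - exact: integrable_mul.
  - apply: aeW => x n _; rewrite /= lee_fin /r normrM.
    by apply: ler_pM => //; exact: gh.
rewrite integral0 => rc; exact: (fine_cvg rc).
Qed.

(** Uniform boundedness of w makes convergence to 0 of the pairings stable under
    L^2 approximation of the test function. The index set is filtered rather
    than nat so that the result also applies to the pairs of indices in a Cauchy
    criterion. *)
Lemma pairing_cvg0_closure (I : Type) (F : set_system I) (FF : Filter F)
    (w : I -> T -> R) (M : R) g :
  (forall i, w i \in L2f) -> (forall i, pairing (w i) (w i) <= M) -> g \in L2f ->
  (forall e, 0 < e -> exists2 h, h \in L2f &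
     pairing (g \- h) (g \- h) <= e /\ pairing (w i) h @[i --> F] --> 0) ->
  pairing (w i) g @[i --> F] --> 0.
Proof.
move=> w2 wM g2 happ; apply/cvgr0Pnorm_lt => e e0.
(* M may be negative when I is empty, hence the absolute value *)
pose dl := (e / 2) ^+ 2 / (`|M| + 1).
have M1 : 0 < `|M| + 1 by rewrite ltr_wpDl.
have dl0 : 0 < dl by rewrite divr_gt0// exprn_gt0// divr_gt0.
have [h h2 [ghd /cvgr0Pnorm_lt wh]] := happ _ dl0.
have := wh (e / 2) (divr_gt0 e0 (ltr0n _ 2)); apply: filterS => i wi.
have -> : pairing (w i) g = pairing (w i) (g \- h) + pairing (w i) h.
  rewrite (pairingC mu (w i) g) (pairingC mu (w i) (g \- h)) (pairingC mu (w i) h).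
  by rewrite pairingBl// subrK.
apply: le_lt_trans (ler_normD _ _) _.
rewrite [X in _ < X](splitr e) ler_ltD//.
have e20 : 0 <= e / 2 by rewrite divr_ge0// ltW.
rewrite -(@ler_pXn2r _ 2) ?nnegrE//.
rewrite -normrX ger0_norm ?sqr_ge0//.
apply: le_trans (pairing_CauchySchwarz (w2 i) (Lfun2B g2 h2)) _.
have -> : (e / 2) ^+ 2 = (`|M| + 1) * dl by rewrite /dl [RHS]mulrC divfK// gt_eqF.
apply: ler_pM => //; [exact: pairing_ge0|exact: pairing_ge0|].
apply: le_trans (wM i) _; apply: le_trans (ler_norm M) _; lra.
Qed.

End L2convergence.

(** * Riesz representation for a finite measure *)

Section FiniteMeasure.
Context d (T : measurableType d) (R : realType) (mu : {measure set T -> \bar R}).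
Hypothesis mufin : (mu setT < +oo)%E.
Implicit Types f g h : T -> R.
Local Notation L2f := (Lfun mu 2%:E).
Local Notation pairing := (L2pairing mu).

Lemma indic_Lfun2 (A : set T) : measurable A -> (\1_A : T -> R) \in L2f.
Proof.
move=> mA; apply: sqr_integrable_Lfun2 => //.
rewrite (eq_integral (fun x => (\1_A x)%:E)); last first.
  by move=> x _; rewrite indicE; case: (_ \in _); rewrite ?expr0n ?expr1n.
rewrite integral_indic// setIT; apply: le_lt_trans mufin.
by apply: le_measure; rewrite ?inE.
Qed.

(** Indicators are total in L^2: a property stable under linear combinations and
    L^2 limits holds everywhere as soon as it holds for indicators. The positive
    and negative parts are treated separately because monotone approximation by
    simple functions is available for nonnegative functions. *)
Lemma Lfun2_rect (P : (T -> R) -> Prop) :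
  P (fun=> 0) ->
  (forall k (A : set T) f, measurable A -> f \in L2f -> P f ->
     P (fun x => k * \1_A x + f x)) ->
  (forall f g, f \in L2f -> g \in L2f -> P f -> P g -> P (f \- g)) ->
  (forall (g_ : nat -> T -> R) g, g \in L2f -> (forall n, g_ n \in L2f) ->
     (forall n, P (g_ n)) ->
     pairing (g \- g_ n) (g \- g_ n) @[n --> \oo] --> 0 -> P g) ->
  forall g, g \in L2f -> P g.
Proof.
move=> P0 PD PB Pcl.
have Ps (s : {nnsfun T >-> R}) : (s : T -> R) \in L2f /\ P s.
  pose Q (f : T -> R) := f \in L2f /\ P f.
  apply: (@nnsfun_rect_indic _ _ _ Q); first by split => //; exact: Lfun2_0.
  move=> k A f mA [f2 Pf]; split; last exact: PD.
  by apply: Lfun2_lin => //; exact: indic_Lfun2.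
have Pge0 g : g \in L2f -> (forall x, 0 <= g x) -> P g.
  move=> g2 g0; have [s [_ sg sc]] := nnsfun_below (measurable_Lfun2 g2) g0.
  apply: (Pcl (fun n => s n : T -> R)) => //; [by move=> n; case: (Ps (s n))..|].
  apply: (@Lfun2_dominated_cvg _ _ _ _ _ g g) => //.
    by move=> n; case: (Ps (s n)).
  by move=> n x; rewrite ger0_norm ?subr_ge0// gerBl.
move=> g g2.
have mg := measurable_Lfun2 g2.
have gp2 : (fun x => Num.max (g x) 0) \in L2f.
  apply: (Lfun2_le _ g2); first exact: measurable_maxr.
  by move=> x; rewrite /Num.max; case: ltP => //; rewrite normr0.
have gn2 : (fun x => Num.max (- g x) 0) \in L2f.
  apply: (Lfun2_le _ g2); first by apply: measurable_maxr => //; exact: measurableT_comp.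
  by move=> x; rewrite /Num.max; case: ltP => //; rewrite ?normr0 ?normrN.
have -> : g = (fun x => Num.max (g x) 0) \- (fun x => Num.max (- g x) 0).
  apply/funext => x /=; rewrite /Num.max oppr_lt0.
  by case: ltgtP => [||->]; rewrite ?subr0 ?sub0r ?opprK.
apply: PB => //; apply: Pge0 => // x; by rewrite le_max lexx orbT.
Qed.

(** Forms are defined on all functions, but linearity and boundedness constrain
    them on L^2 only; this avoids working with classes. *)
Definition L2_linear (L : (T -> R) -> R) := forall k f g,
  f \in L2f -> g \in L2f -> L (fun x => k * f x + g x) = k * L f + L g.

Definition L2_bounded (L : (T -> R) -> R) (M : R) := forall f,
  f \in L2f -> L f ^+ 2 <= M * pairing f f.

Lemma L2_linear0 L : L2_linear L -> L (fun=> 0) = 0.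
Proof.
move=> Ll; have := Ll 1 _ _ (Lfun2_0 mu) (Lfun2_0 mu).
under eq_fun do rewrite mulr0 addr0.
by move=> h; lra.
Qed.

Lemma L2_linearB L f g : L2_linear L -> f \in L2f -> g \in L2f ->
  L (f \- g) = L f - L g.
Proof.
move=> Ll f2 g2; have := Ll (- 1) _ _ g2 f2.
under eq_fun do rewrite mulN1r addrC.
by move=> ->; rewrite mulN1r addrC.
Qed.

Lemma sqr_cvg0 (a : nat -> R) : (a n ^+ 2 @[n --> \oo] --> 0) -> a n @[n --> \oo] --> 0.
Proof.
move=> /cvgr0Pnorm_lt a0; apply/cvgr0Pnorm_lt => e e0.
have := a0 (e ^+ 2) (exprn_gt0 2 e0); apply: filterS => n.
by rewrite normrX ltr_pXn2r ?nnegrE// ltW.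
Qed.

Lemma L2_bounded_cvg L M (g_ : nat -> T -> R) g :
  L2_linear L -> L2_bounded L M -> (forall n, g_ n \in L2f) -> g \in L2f ->
  pairing (g \- g_ n) (g \- g_ n) @[n --> \oo] --> 0 ->
  L (g_ n) @[n --> \oo] --> L g.
Proof.
move=> Ll Lb gn2 g2 gg.
apply/subr_cvg0/sqr_cvg0.
apply: (@squeeze_cvgr _ _ _ _ (fun=> 0) (fun n => M * pairing (g \- g_ n) (g \- g_ n))).
- apply: nearW => n; rewrite sqr_ge0 /= -sqrrN opprB -L2_linearB//.
  by apply: Lb; exact: Lfun2B.
- exact: cvg_cst.
- by rewrite -[X in _ --> X](mulr0 M); apply: cvgMr.
Qed.

(** Countable additivity: the indicators of the partial unions converge in L^2 to
    the indicator of the union, by dominated convergence, since the measure is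
    finite. *)
Lemma L2_charge L M : L2_linear L -> L2_bounded L M ->
  exists nu : {charge set T -> \bar R}, forall A, measurable A -> nu A = (L \1_A)%:E.
Proof.
move=> Ll Lb; pose nu (A : set T) : \bar R := (L \1_A)%:E.
have nu0 : nu set0 = 0%E.
  rewrite /nu (_ : \1_set0 = fun=> 0) ?L2_linear0//.
  by apply/funext => x; rewrite indicE in_set0.
have nufin A : measurable A -> nu A \is a fin_num by [].
have nuS : semi_sigma_additive nu.
  move=> F mF tF mUF.
  pose G n := \big[setU/set0]_(i < n) F i.
  have mG n : measurable (G n) by exact: bigsetU_measurable.
  have sumE n : \sum_(0 <= i < n) L \1_(F i) = L \1_(G n).
    elim: n => [|n IH].
      by rewrite big_nil /G big_ord0; move: nu0 => -[->].
    rewrite big_nat_recr//= IH /G big_ord_recr /= -/(G n).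
    rewrite addrC -[X in X + _]mul1r -Ll; [|exact: indic_Lfun2..].
    congr L; apply/funext => x; rewrite mul1r !indicE in_setU addrC.
    have : ~ (G n x /\ F n x).
      move=> [+ Fx]; rewrite /G -bigcup_mkord => -[i /= ni Fix].
      have := tF i n I I; move=> H; have E : i = n by apply: H; exists x.
      by rewrite E ltnn in ni.
    case: (boolP (x \in G n)) => [/set_mem Gx|_]; last by rewrite add0r.
    by case: (boolP (x \in F n)) => [/set_mem Fx []//|_]; rewrite addr0.
  rewrite (_ : (fun n => _) = (fun n => (L \1_(G n))%:E)); last first.
    by apply/funext => n; rewrite -sumE sumEFin.
  apply: cvg_EFin; first exact: nearW.
  apply: (@L2_bounded_cvg L M) => //; [by move=> n; exact: indic_Lfun2|exact: indic_Lfun2|].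
  apply: (@Lfun2_dominated_cvg _ _ _ _ _ _ (\1_setT)) => //.
  - by move=> n; exact: indic_Lfun2.
  - exact: indic_Lfun2.
  - exact: indic_Lfun2.
  - move=> n x; rewrite !indicE in_setT.
    by case: (_ \in _); case: (_ \in _); rewrite ?subrr ?subr0 ?sub0r ?normrN ?normr0 ?normr1.
  - move=> x; apply: cvg_near_cst.
    have [[k _ Fk]|nF] := pselect ((\bigcup_n F n) x).
      exists k.+1 => // n /= kn; rewrite !indicE !mem_set//; first by exists k.
      by rewrite /G -bigcup_mkord; exists k.
    apply: nearW => n; rewrite !indicE !memNset//.
    by rewrite /G -bigcup_mkord => -[i _ Fi]; apply: nF; exists i.
pose nu' : {charge set T -> \bar R} := HB.pack nu (isCharge.Build _ _ _ nu nu0 nufin nuS).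
by exists nu'.
Qed.

(** The charge of [L2_charge] is absolutely continuous because L vanishes on
    functions of norm 0, so the Radon-Nikodym theorem applies. *)
Lemma L2_density L M : L2_linear L -> L2_bounded L M ->
  exists f, mu.-integrable setT (EFin \o f) /\
    forall A, measurable A -> L \1_A = \int[mu]_x (f x * \1_A x).
Proof.
move=> Ll Lb; have [nu nuE] := L2_charge Ll Lb.
pose m : {finite_measure set T -> \bar R} := mfrestr measurableT mufin.
have mE A : m A = mu A by rewrite /m /= /mfrestr /mrestr setIT.
have intE D (f : T -> \bar R) : (\int[m]_(x in D) f x = \int[mu]_(x in D) f x)%E.
  by apply: eq_measure_integral => A _ _; exact: mE.
have nm : nu `<< m.
  apply/null_content_dominatesP => A mA mA0.
  have A0 : mu A = 0%E by rewrite -mE.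
  rewrite nuE//; have := Lb _ (indic_Lfun2 mA).
  have -> : pairing \1_A \1_A = 0.
    rewrite /L2pairing /Rintegral (eq_integral (fun x => (\1_A x)%:E)).
      by rewrite integral_indic// setIT A0.
    by move=> x _; rewrite indicE; case: (_ \in _); rewrite ?mulr0 ?mulr1.
  rewrite mulr0 => L0; congr EFin; apply/eqP; rewrite -sqrf_eq0.
  by rewrite eq_le L0 sqr_ge0.
pose r := Radon_Nikodym nu m.
have rfin x : r x \is a fin_num by exact: Radon_Nikodym_fin_num.
have rE x : (fine (r x))%:E = r x by rewrite fineK.
have ir : mu.-integrable setT r.
  have /integrableP[mr ri] := Radon_Nikodym_integrable nm.
  by apply/integrableP; split => //; rewrite -intE.
exists (fine \o r); split.
  by rewrite (_ : EFin \o _ = r)//; apply/funext => x /=; exact: rE.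
move=> A mA; apply: EFin_inj; rewrite -nuE//.
rewrite (Radon_Nikodym_integral nm mA) intE -/r.
have rA : (fun x => ((fine \o r) x * \1_A x)%:E) = (r \_ A)%E.
  apply/funext => x; rewrite patchE indicE /=.
  by case: (_ \in _); rewrite ?mulr1 ?rE ?mulr0.
rewrite /Rintegral rA -integral_mkcond fineK//; apply: integrable_fin_num => //.
exact: integrableS ir.
Qed.

(** If s is a simple function below the positive part of the density f, then
    s^2 <= f s, so |s|^2 <= L s <= (M |s|^2)^(1/2) and |s|^2 <= M. Monotone
    convergence transfers this bound to the positive part itself. *)
Lemma L2_density_pos L M f : L2_linear L -> L2_bounded L M ->
  mu.-integrable setT (EFin \o f) ->
  (forall A, measurable A -> L \1_A = \int[mu]_x (f x * \1_A x)) ->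
  (fun x => Num.max (f x) 0) \in L2f.
Proof.
move=> Ll Lb fi fA.
have mf : measurable_fun setT f by apply/measurable_EFinP; exact: measurable_int fi.
have fAi A mA := @integrable_mul_indic _ _ _ mu f A fi mA.
have sE (s : {nnsfun T >-> R}) : [/\ (s : T -> R) \in L2f,
    mu.-integrable setT (EFin \o (fun x => f x * s x)) &
    L s = \int[mu]_x (f x * s x)].
  pose Q (h : T -> R) := [/\ h \in L2f,
    mu.-integrable setT (EFin \o (fun x => f x * h x)) &
    L h = \int[mu]_x (f x * h x)].
  apply: (@nnsfun_rect_indic _ _ _ Q).
    split; first exact: Lfun2_0.
      under eq_fun do rewrite mulr0; exact: integrable0.
    rewrite (L2_linear0 Ll); under eq_Rintegral do rewrite mulr0.
    by rewrite Rintegral_cst// mul0r.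
  move=> k A h mA [h2 hi Lh].
  have E : (fun x => f x * (k * \1_A x + h x)) =
      (fun x => k * (f x * \1_A x) + f x * h x).
    by apply/funext => x; rewrite mulrDr mulrCA.
  have kAi : mu.-integrable setT (EFin \o (fun x => k * (f x * \1_A x))).
    exact: (integrableZl measurableT k (fAi A mA)).
  split; first by apply: Lfun2_lin => //; exact: indic_Lfun2.
    by rewrite E; exact: (integrableD measurableT kAi hi).
  rewrite Ll//; last exact: indic_Lfun2.
  by rewrite E RintegralD// RintegralZl//; [rewrite Lh fA|exact: fAi].
have mp : measurable_fun setT (fun x => Num.max (f x) 0) by exact: measurable_maxr.
have p0 x : 0 <= Num.max (f x) 0 by rewrite le_max lexx orbT.
have [s [snd sle sc]] := nnsfun_below mp p0.
have sM n : pairing (s n) (s n) <= `|M|.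
  have [s2 si Ls] := sE (s n).
  have : pairing (s n) (s n) <= L (s n).
    rewrite Ls; apply: le_Rintegral => //; first exact: integrable_mul.
    move=> x _; have := sle n x; have s0 : 0 <= s n x by [].
    rewrite /Num.max; case: ltP => f0 sx.
      have -> : s n x = 0 by apply/eqP; rewrite eq_le sx s0.
      by rewrite !mulr0.
    by apply: ler_wpM2r.
  have := Lb _ s2; have := pairing_ge0 mu (s n); have := ler_norm M.
  move: (pairing _ _) (L _) => P l MM P0 lM Pl.
  rewrite leNgt; apply/negP => MP.
  have P1 : 0 < P by exact: le_lt_trans MP.
  have := le_lt_trans lM (le_lt_trans (ler_wpM2r P0 MM) (_ : _ < P * P)).
  rewrite ltr_pM2r// => /(_ MP); rewrite ltNge -expr2.
  by rewrite ler_pXn2r ?nnegrE ?Pl// (le_trans P0).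
apply: sqr_integrable_Lfun2 => //.
have := @cvg_monotone_convergence _ _ _ mu setT measurableT
  (fun n x => (s n x * s n x)%:E).
move=> H.
have {}H : (\int[mu]_x (s n x * s n x)%:E)%E @[n --> \oo] -->
    (\int[mu]_x (Num.max (f x) 0 ^+ 2)%:E)%E.
  rewrite (eq_integral (fun x => limn (fun n => (s n x * s n x)%:E))); last first.
    move=> x _; apply/esym/cvg_lim => //; apply: cvg_EFin; first exact: nearW.
    by rewrite expr2; apply: cvgM; exact: sc.
  apply: H => //.
  - by move=> n; apply/measurable_EFinP; exact: measurable_funM.
  - by move=> n x _; rewrite lee_fin mulr_ge0.
  - by move=> x _ m n mn; rewrite lee_fin ler_pM//; exact: snd.
apply: (@le_lt_trans _ _ `|M|%:E); last exact: ltry.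
rewrite -(cvg_lim _ H)//; apply: lime_le; first by apply/cvg_ex; eexists; exact: H.
apply: nearW => n; have [s2 _ _] := sE (s n).
by rewrite -EFin_pairing// lee_fin.
Qed.

(** The density is in L^2 by [L2_density_pos], applied to L and to its opposite,
    and it represents L on indicators, hence on L^2 by totality. *)
Lemma L2_Riesz L M : L2_linear L -> L2_bounded L M ->
  exists v : LspaceType2 mu, forall g, g \in L2f -> L g = pairing v g.
Proof.
move=> Ll Lb; have [f [fi fA]] := L2_density Ll Lb.
have mf : measurable_fun setT f by apply/measurable_EFinP; exact: measurable_int fi.
have fp2 := L2_density_pos Ll Lb fi fA.
have fn2 : (fun x => Num.max (- f x) 0) \in L2f.
  apply: (@L2_density_pos (fun g => - L g) M (fun x => - f x)).
  - by move=> k g h g2 h2; rewrite Ll// opprD mulrN.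
  - by move=> g g2; rewrite sqrrN; exact: Lb.
  - exact: (integrableN fi).
  - move=> A mA; rewrite fA// -mulN1r -RintegralZl//.
      by apply: eq_Rintegral => x _; rewrite mulN1r mulNr.
    exact: integrable_mul_indic.
have f2 : f \in L2f.
  rewrite (_ : f = (fun x => Num.max (f x) 0) \- (fun x => Num.max (- f x) 0)).
    exact: Lfun2B.
  apply/funext => x /=; rewrite /Num.max oppr_lt0.
  by case: ltgtP => [||->]; rewrite ?subr0 ?sub0r ?opprK.
have [v vf] := Lfun_Lspace2 f2; exists v => g g2.
have -> : pairing v g = pairing f g.
  exact: (pairing_ae (Lspace2_Lfun v) f2 g2 vf).
have Pl : L2_linear (pairing f).
  move=> k h1 h3 h12 h32; rewrite !(pairingC _ f).
  by rewrite (pairingDl (Lfun2Z k h12) h32 f2) pairingZl.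
have Pb : L2_bounded (pairing f) (pairing f f).
  by move=> h1 h12; exact: pairing_CauchySchwarz.
apply: (@Lfun2_rect (fun g => L g = pairing f g)) g2.
- by rewrite (L2_linear0 Ll) (L2_linear0 Pl).
- move=> k A h mA h2 Lh; have A2 := indic_Lfun2 mA.
  by rewrite Ll// Pl// Lh fA.
- by move=> h1 h2 h12 h22 L1 L2; rewrite (L2_linearB Ll)// (L2_linearB Pl)// L1 L2.
- move=> g_ h h2 g_2 Lg hg.
  have Lc := L2_bounded_cvg Ll Lb g_2 h2 hg.
  have Pc := L2_bounded_cvg Pl Pb g_2 h2 hg.
  apply: (cvg_unique _ Lc) => //.
  by rewrite (_ : (fun n => L (g_ n)) = (fun n => pairing f (g_ n)))//; apply/funext.
Qed.

End FiniteMeasure.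

(** * Weak compactness in L^2 *)

Section CountablyGenerated.
Context d (T : measurableType d) (R : realType) (mu : {measure set T -> \bar R}).
Hypothesis mufin : (mu setT < +oo)%E.
Variable A : nat -> set T.
Hypothesis mA : forall i, measurable (A i).
Hypothesis AI : forall i j, exists k, A i `&` A j = A k.
Hypothesis AT : exists k, A k = setT.
Hypothesis Agen : measurable `<=` <<s range A >>.
Implicit Types f g h : T -> R.
Local Notation L2f := (Lfun mu 2%:E).
Local Notation pairing := (L2pairing mu).
Local Notation L2 := (LspaceType2 mu).

(** The sets whose indicators pass the test form a lambda-system. Stability under
    increasing unions is where the bound on w matters: the error is controlled
    by the measure of the remaining part, uniformly in w. *)
Lemma pairing_cvg0_indic (I : Type) (F : set_system I) (FF : Filter F)
    (w : I -> T -> R) (M : R) :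
  (forall k, w k \in L2f) -> (forall k, pairing (w k) (w k) <= M) ->
  (forall i, pairing (w k) \1_(A i) @[k --> F] --> 0) ->
  forall B, measurable B -> pairing (w k) \1_B @[k --> F] --> 0.
Proof.
move=> w2 wM wA.
pose H := [set B | measurable B /\ pairing (w k) \1_B @[k --> F] --> 0].
suff HH : <<s range A >> `<=` H by move=> B /Agen/HH[].
apply: lambda_system_subset => //.
- move=> _ _ [i _ <-] [j _ <-]; have [k ->] := AI i j; by exists k.
- split => //.
  + by have [k <-] := AT; split.
  + move=> B C CB [mB wB] [mC wC]; split; first exact: measurableD.
    have -> : (fun k => pairing (w k) \1_(B `\` C)) =
        (fun k => pairing (w k) \1_B - pairing (w k) \1_C).
      apply/funext => k; have B2 := indic_Lfun2 mufin mB.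
      have C2 := indic_Lfun2 mufin mC.
      rewrite !(pairingC _ (w k)) -pairingBl//; congr L2pairing.
      apply/funext => x /=; rewrite !indicE in_setD.
      case: (boolP (x \in C)) => [xC|_]; last by rewrite andbT subr0.
      by rewrite (mem_set (CB _ (set_mem xC))) subrr.
    by rewrite -(subrr 0); exact: cvgB.
  + move=> B ndB HB; have mB i : measurable (B i) by case: (HB i).
    have mU : measurable (\bigcup_i B i) by exact: bigcup_measurable.
    split => //; have U2 := indic_Lfun2 mufin mU.
    apply: (pairing_cvg0_closure FF w2 wM U2) => e e0.
    have /cvgr0Pnorm_lt/(_ e e0)[n _ Hn] : pairing (\1_(\bigcup_i B i) \- \1_(B n))
        (\1_(\bigcup_i B i) \- \1_(B n)) @[n --> \oo] --> 0.
      apply: (@Lfun2_dominated_cvg _ _ _ _ _ _ (\1_setT)) => //.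
      - by move=> n; exact: indic_Lfun2.
      - exact: indic_Lfun2.
      - move=> n x; rewrite !indicE in_setT.
        by case: (_ \in _); case: (_ \in _);
          rewrite ?subrr ?subr0 ?sub0r ?normrN ?normr0 ?normr1.
      - move=> x; apply: cvg_near_cst.
        have [[k _ Bk]|nB] := pselect ((\bigcup_n B n) x).
          exists k => // n /= kn; rewrite !indicE !mem_set//; first by exists k.
          by move: x Bk; apply/subsetPset/ndB.
        apply: nearW => n; rewrite !indicE !memNset//.
        by move=> Bn; apply: nB; exists n.
    exists (\1_(B n)); first exact: indic_Lfun2.
    split; last by case: (HB n).
    by apply: le_trans (ler_norm _) (ltW _); exact: Hn (leqnn n).
- by move=> _ [i _ <-]; split.
Qed.

Lemma pairing_cvg0 (I : Type) (F : set_system I) (FF : Filter F)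
    (w : I -> T -> R) (M : R) :
  (forall k, w k \in L2f) -> (forall k, pairing (w k) (w k) <= M) ->
  (forall i, pairing (w k) \1_(A i) @[k --> F] --> 0) ->
  forall g, g \in L2f -> pairing (w k) g @[k --> F] --> 0.
Proof.
move=> w2 wM wA g g2.
have wB := pairing_cvg0_indic FF w2 wM wA.
apply: (@Lfun2_rect _ _ _ mu mufin (fun g => pairing (w k) g @[k --> F] --> 0)) g2.
- have -> : (fun k => pairing (w k) (fun=> 0)) = fun=> 0; last exact: cvg_cst.
  apply/funext => k; rewrite /L2pairing; under eq_Rintegral do rewrite mulr0.
  by rewrite Rintegral_cst// mul0r.
- move=> k B f mB f2 wf; have B2 := indic_Lfun2 mufin mB.
  have -> : (fun i => pairing (w i) (fun x => k * \1_B x + f x)) =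
      (fun i => k * pairing (w i) \1_B + pairing (w i) f).
    apply/funext => i; rewrite !(pairingC _ (w i)) (pairingDl (Lfun2Z k B2) f2)//.
    by rewrite pairingZl.
  rewrite -(addr0 0) -[X in X + _](mulr0 k); apply: cvgD => //.
  by apply: cvgMr; exact: wB.
- move=> f h f2 h2 wf wh.
  have -> : (fun i => pairing (w i) (f \- h)) =
      (fun i => pairing (w i) f - pairing (w i) h).
    by apply/funext => i; rewrite !(pairingC _ (w i)) pairingBl.
  by rewrite -(subrr 0); exact: cvgB.
- move=> g_ h h2 g_2 wg gh; apply: (pairing_cvg0_closure FF w2 wM h2) => e e0.
  have /cvgr0Pnorm_lt/(_ e e0)[n _ Hn] := gh.
  exists (g_ n) => //; split => //.
  by apply: le_trans (ler_norm _) (ltW _); exact: Hn (leqnn n).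
Qed.

(** The definition of weak convergence tests against classes, through their
    chosen representatives; any square-integrable function may be used. *)
Lemma weak_cvgP (u_ : nat -> L2) (u : L2) : weak_cvg u_ u <->
  forall g, g \in L2f -> pairing (u_ k) g @[k --> \oo] --> pairing u g.
Proof.
split => [uu g g2|uu g]; last exact: uu (Lspace2_Lfun g).
have [v vg] := Lfun_Lspace2 g2.
have E (z : L2) : pairing z g = pairing z v.
  rewrite (pairingC _ z g) (pairingC _ z v); apply/esym.
  exact: (pairing_ae (Lspace2_Lfun v) g2 (Lspace2_Lfun z) vg).
rewrite E; under eq_fun do rewrite E.
exact: uu.
Qed.

Lemma weak_cvg_indic (u_ : nat -> L2) (u : L2) (M : R) :
  (forall k, pairing (u_ k) (u_ k) <= M) ->
  (forall i, pairing (u_ k) \1_(A i) @[k --> \oo] --> pairing u \1_(A i)) ->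
  weak_cvg u_ u.
Proof.
move=> uM uA; apply/weak_cvgP => g g2.
have u_2 k := Lspace2_Lfun (u_ k); have u2 := Lspace2_Lfun u.
have E h k : h \in L2f -> pairing (u_ k \- u) h = pairing (u_ k) h - pairing u h.
  by move=> h2; rewrite pairingBl.
apply/subr_cvg0; under eq_fun do rewrite -E//.
apply: (@pairing_cvg0 _ _ _ _ (2 * M + 2 * pairing u u)) => //.
- by move=> k; exact: Lfun2B.
- by move=> k; apply: le_trans (pairingB_le _ _) _ => //; rewrite lerD2r ler_pM2l.
- move=> i; have A2 := indic_Lfun2 mufin (mA i).
  by under eq_fun do rewrite E//; apply/subr_cvg0.
Qed.

(** The pairings with a fixed function form a Cauchy sequence, by [pairing_cvg0]
    for the differences u_k - u_l along pairs of indices; their limit is a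
    bounded linear form, represented by [L2_Riesz]. *)
Lemma L2_bounded_weak_limit (u_ : nat -> L2) (M : R) :
  (forall k, pairing (u_ k) (u_ k) <= M) ->
  (forall i, cvgn (fun k => pairing (u_ k) \1_(A i))) ->
  exists u : L2, weak_cvg u_ u.
Proof.
move=> uM uA; have u_2 k := Lspace2_Lfun (u_ k).
have cu g : g \in L2f -> cvgn (fun k => pairing (u_ k) g).
  move=> g2; pose w (p : nat * nat) := (u_ p.1 : T -> R) \- u_ p.2.
  have wE p h : h \in L2f -> pairing (w p) h = pairing (u_ p.1) h - pairing (u_ p.2) h.
    by move=> h2; rewrite pairingBl.
  have : pairing (w p) g @[p --> (\oo, \oo)] --> 0.
    apply: (@pairing_cvg0 _ _ _ w (2 * M + 2 * M)) => //.
    - by move=> p; exact: Lfun2B.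
    - move=> p; apply: le_trans (pairingB_le _ _) _ => //.
      by rewrite lerD// ler_pM2l.
    - move=> i; have A2 := indic_Lfun2 mufin (mA i).
      under eq_fun do rewrite wE//.
      have /cvg_ex[l ul] := uA i.
      rewrite -(subrr l); apply: cvgB.
        by apply: cvg_comp ul; exact: cvg_fst.
      by apply: cvg_comp ul; exact: cvg_snd.
  move=> /cvgr0Pnorm_lt wg; apply/cauchy_cvgP/cauchy_ballP => e e0.
  have [[P Q] /= [oP oQ] PQ] := wg e e0.
  exists ((fun k => pairing (u_ k) g) @` P, (fun k => pairing (u_ k) g) @` Q) => /=.
    by split; [apply: filterS oP|apply: filterS oQ] => k Hk; exists k.
  move=> [y z] [/= [k Pk <-] [l Ql <-]]; rewrite /ball /=.
  by have := PQ (k, l); rewrite /= wE//; apply; split.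
pose L g := limn (fun k => pairing (u_ k) g).
have Lc g : g \in L2f -> pairing (u_ k) g @[k --> \oo] --> L g by move=> /cu.
have Ll : L2_linear mu L.
  move=> k f g f2 g2; apply/cvg_lim => //.
  have -> : (fun i => pairing (u_ i) (fun x => k * f x + g x)) =
      (fun i => k * pairing (u_ i) f + pairing (u_ i) g).
    apply/funext => i; rewrite !(pairingC _ (u_ i)).
    by rewrite (pairingDl (Lfun2Z k f2) g2)// pairingZl.
  by apply: cvgD; [apply: cvgMr; exact: Lc|exact: Lc].
have Lb : L2_bounded mu L M.
  move=> g g2; have Lc2 : pairing (u_ k) g ^+ 2 @[k --> \oo] --> L g ^+ 2.
    by rewrite expr2; under eq_fun do rewrite expr2; apply: cvgM; exact: Lc.
  rewrite -(cvg_lim _ Lc2)//; apply: limr_le; first by apply/cvg_ex; eexists; exact: Lc2.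
  apply: nearW => k; apply: le_trans (pairing_CauchySchwarz (u_2 k) g2) _.
  by apply: ler_wpM2r => //; exact: pairing_ge0.
have [u Lu] := L2_Riesz mufin Ll Lb.
by exists u; apply/weak_cvgP => g g2; rewrite -Lu//; exact: Lc.
Qed.

Lemma L2_weak_compact (J : finType) (u_ : J -> nat -> L2) (M : R) :
  (forall j k, pairing (u_ j k) (u_ j k) <= M) ->
  exists2 s, increasing_seq s & forall j, exists u, weak_cvg (u_ j \o s) u.
Proof.
move=> uM.
have [|s si sc] := @bounded_subsequence R (J * nat)%type
    (fun p k => pairing (u_ p.1 k) \1_(A p.2)).
  move=> [j i]; have A2 := indic_Lfun2 mufin (mA i).
  pose C := M * pairing \1_(A i) \1_(A i).
  exists (C + 1); split; first exact: num_real.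
  move=> x Cx k _ /=; apply: le_trans (ltW Cx).
  have : pairing (u_ j k) \1_(A i) ^+ 2 <= C.
    apply: le_trans (pairing_CauchySchwarz (Lspace2_Lfun _) A2) _.
    by apply: ler_wpM2r => //; exact: pairing_ge0.
  rewrite -real_normK ?num_real//; have := normr_ge0 (pairing (u_ j k) \1_(A i)).
  by move: `|_| => y y0 y2; have := sqr_ge0 (y - 1); nra.
exists s => // j; apply: (@L2_bounded_weak_limit _ M) => [k|i]; first exact: uM.
exact: (sc (j, i)).
Qed.

(** * Gamma-compactness *)

Lemma L2dist2E (u v : L2) : L2dist2 u v = (pairing (u \- v) (u \- v))%:E.
Proof.
by rewrite -Lnorm2_pairing//; apply: Lfun2B; exact: Lspace2_Lfun.
Qed.

Lemma L2dist2_ge0 (u v : L2) : (0 <= L2dist2 u v)%E.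
Proof. by rewrite L2dist2E lee_fin pairing_ge0. Qed.

(** A countable family of weak neighbourhoods: the first component of c is both
    the number of tests and the precision, and the second one lists the
    prescribed approximate values. On bounded sets it is a base of the weak
    topology. *)
Definition rational_nbhs (c : nat * seq rat) : set L2 := [set v | forall i, (i < c.1)%N ->
  `|pairing v \1_(A i) - ratr (nth 0 c.2 i)| < c.1.+1%:R^-1].

Lemma rational_nbhs_weak c (u_ : nat -> L2) (u : L2) :
  weak_cvg u_ u -> rational_nbhs c u -> \forall k \near \oo, rational_nbhs c (u_ k).
Proof.
move=> /weak_cvgP uu cu.
have H (i : 'I_c.1) : \forall k \near \oo,
    `|pairing (u_ k) \1_(A i) - ratr (nth 0 c.2 i)| < c.1.+1%:R^-1.
  have ui := uu _ (indic_Lfun2 mufin (mA i)).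
  have : `|pairing (u_ k) \1_(A i) - ratr (nth 0 c.2 i)| @[k --> \oo] -->
      `|pairing u \1_(A i) - ratr (nth 0 c.2 i)|.
    by apply: cvg_norm; apply: cvgB => //; exact: cvg_cst.
  by move=> /cvgr_lt; apply; exact: cu.
apply: filterS (filter_forall _ H) => k Hk i ic.
exact: (Hk (Ordinal ic)).
Qed.

Lemma rational_nbhs_ex (u : L2) p : exists q, rational_nbhs (p, q) u.
Proof.
have q_ i : exists q : rat, `|pairing u \1_(A i) - ratr q| < p.+1%:R^-1.
  have r0 : (0 : R) < p.+1%:R^-1 by rewrite invr_gt0.
  have /rat_in_itvoo[q] : pairing u \1_(A i) - p.+1%:R^-1 < pairing u \1_(A i) + p.+1%:R^-1.
    by rewrite ltrD2l (lt_trans _ r0)// oppr_lt0.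
  by rewrite in_itv /= => hq; exists q; rewrite ltr_distlC.
have [q qP] := choice q_; exists (mkseq q p) => i /= ip.
by rewrite nth_mkseq.
Qed.

Lemma pairing_le_dist (u v : L2) :
  pairing u u <= 2 * pairing (u \- v) (u \- v) + 2 * pairing v v.
Proof.
have u2 := Lspace2_Lfun u; have v2 := Lspace2_Lfun v.
have vN2 : (fun x => -1 * v x) \in Lfun mu 2%:E by exact: Lfun2Z.
have := pairingB_le (Lfun2B u2 v2) vN2.
have -> : (u \- v) \- (fun x => -1 * v x) = u.
  by apply/funext => x /=; rewrite mulN1r opprK subrK.
have -> // : pairing (fun x => -1 * v x) (fun x => -1 * v x) = pairing v v.
by apply: eq_Rintegral => x _; rewrite !mulN1r mulrNN.
Qed.

(** Equicoercivity enters in the limsup inequality: a recovery sequence is chosen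
    among almost minimizers on shrinking neighbourhoods of u, and its
    convergence against the tests is weak convergence because the lower bound
    of F by the distance keeps it bounded. *)
Lemma Gamma_compact (J : finType) (F : nat -> J -> L2 -> \bar R) (eta : J -> L2) :
  (forall k j u, (L2dist2 u (eta j) <= F k j u)%E) ->
  exists2 s, increasing_seq s & forall j, Gamma_converges (fun k => F (s k) j).
Proof.
move=> Feta.
have F0 k j u : (0 <= F k j u)%E by apply: le_trans (Feta k j u); exact: L2dist2_ge0.
pose a (p : J * (nat * seq rat)) k := ereal_inf [set F k p.1 v | v in rational_nbhs p.2].
have [s si sc] := ereal_subsequence a; exists s => // j.
pose l c := limn (a (j, c) \o s).
have lc c : a (j, c) \o s @ \oo --> l c by exact: sc.
have l0 c : (0 <= l c)%E.
  apply: lime_ge; first exact: sc.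
  by apply: nearW => k; apply: le_ereal_inf_tmp => _ [v _ <-].
pose G (u : L2) := ereal_sup [set l c | c in [set c | rational_nbhs c u]].
have lG c u : rational_nbhs c u -> (l c <= G u)%E.
  by move=> cu; apply: ereal_sup_ubound; exists c.
have G0 u : (0 <= G u)%E.
  by have [q qu] := rational_nbhs_ex u 0; exact: le_trans (l0 _) (lG _ _ qu).
exists G => //; split => [u_ u uu|u].
  apply: ge_ereal_sup => _ [c cu <-].
  apply: (le_limn_einf_cvg _ (lc c)).
  have := rational_nbhs_weak uu cu; apply: filterS => k ck.
  by apply: ereal_inf_lbound; exists (u_ k).
(* limsup inequality: where G is infinite, a constant sequence recovers it *)
have [Gy|Gy] := eqVneq (G u) +oo%E.
  exists (fun=> u); first by move=> g; exact: cvg_cst.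
  by rewrite Gy leey.
have GE : G u = (fine (G u))%:E by rewrite fineK// ge0_fin_numE// ltey.
set c := fine (G u) in GE.
have [q qP] := choice (rational_nbhs_ex u).
pose Q p k v := rational_nbhs (p, q p) v /\ (F (s k) j v < (c + p.+1%:R^-1)%:E)%E.
have QK p : \forall k \near \oo, exists v, Q p k v.
  have : (l (p, q p) < (c + p.+1%:R^-1)%:E)%E.
    by apply: le_lt_trans (lG _ _ (qP p)) _; rewrite GE lte_fin ltrDl invr_gt0.
  move=> /open_ereal_lt'/lc H.
  have {}H : \forall k \near \oo,
      (a (j, (p, q p)) (s k) < (c + p.+1%:R^-1)%:E)%E by exact: H.
  apply: filterS H => k.
  by move=> /ereal_inf_lt[_ [v vV <-] vc]; exists v.
have [phi [v_ [phioo Qv Qu]]] := diagonal_selection u QK.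
have cp p : c + p.+1%:R^-1 <= c + 1.
  by rewrite lerD2l invf_le1// ler1n.
exists v_.
  apply: (@weak_cvg_indic _ _
    (2 * (c + 1) + 2 * pairing (eta j) (eta j) + pairing u u)).
    move=> k; have c0 : 0 <= c by rewrite fine_ge0.
    have e0 := pairing_ge0 mu (eta j).
    case: (Qu k) => [[_ Fk]|->]; last by rewrite lerDr; lra.
    have Fc : pairing (v_ k \- eta j) (v_ k \- eta j) <= c + 1.
      rewrite -lee_fin -L2dist2E; apply: le_trans (Feta (s k) j (v_ k)) _.
      by apply: le_trans (ltW Fk) _; rewrite lee_fin.
    have := pairing_le_dist (v_ k) (eta j); have := pairing_ge0 mu u.
    by move=> ? ?; lra.
  move=> i; apply/cvgrPdist_lt => e e0.
  have e2 : 0 < e / 2 by rewrite divr_gt0.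
  have near1 : \forall k \near \oo, (phi k).+1%:R^-1 < e / 2 :> R.
    by have [N _ HN] := phioo _ (near_infty_natSinv_lt (PosNum e2)); exists N => // k /HN.
  have near2 : \forall k \near \oo, (i < phi k)%N.
    by have [N _ HN] := phioo [set m | (i < m)%N] (nbhs_infty_gt i); exists N => // k /HN.
  apply: filterS3 Qv near1 near2 => k [Vk _] ke ik.
  have := Vk i ik; have := qP (phi k) i ik; rewrite /= => h1 h2.
  apply: le_lt_trans (ler_distD (ratr (nth 0 (q (phi k)) i)) _ _) _.
  by rewrite (splitr e) ltrD// ?(lt_trans h1)// distrC (lt_trans h2).
apply/lee_addgt0Pr => e e0; apply: limn_esup_le.
have near1 : \forall k \near \oo, (phi k).+1%:R^-1 < e :> R.
  by have [N _ HN] := phioo _ (near_infty_natSinv_lt (PosNum e0)); exists N => // k /HN.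
apply: filterS2 Qv near1 => k [_ Fk] ke.
by apply: le_trans (ltW Fk) _; rewrite GE -EFinD lee_fin lerD2l ltW.
Qed.

(** * Minimizers of the lower and upper levels *)

Local Notation dist2 u v := (pairing (u \- v) (u \- v)).

(** The affine function tangent at u to the convex functional v |-> |v - c|^2. It
    is a minorant, by convexity, and weakly continuous; it replaces the lower limit of the
    norm by a limit, which can be subtracted, and summed over components. *)
Definition tangent (c u v : L2) : R :=
  2 * pairing (v \- c) (u \- c) - pairing (u \- c) (u \- c).

Lemma tangent_le (c u v : L2) : tangent c u v <= dist2 v c.
Proof.
have c2 := Lspace2_Lfun c; have u2 := Lspace2_Lfun u; have v2 := Lspace2_Lfun v.
have f2 := Lfun2B v2 c2; have g2 := Lfun2B u2 c2; have fg2 := Lfun2B f2 g2.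
have := pairing_ge0 mu ((v \- c) \- (u \- c)).
rewrite (pairingBl f2 g2 fg2) (pairingC _ (v \- c)) (pairingC _ (u \- c)).
rewrite !(pairingBl f2 g2)// (pairingC _ (u \- c) (v \- c)) /tangent.
by move=> h; lra.
Qed.

Lemma tangent_cvg (c u : L2) (u_ : nat -> L2) : weak_cvg u_ u ->
  tangent c u (u_ k) @[k --> \oo] --> dist2 u c.
Proof.
move=> /weak_cvgP uu; have c2 := Lspace2_Lfun c; have u2 := Lspace2_Lfun u.
have g2 := Lfun2B u2 c2.
have E v : v \in Lfun mu 2%:E ->
  2 * pairing (v \- c) (u \- c) - dist2 u c =
  2 * (pairing v (u \- c) - pairing c (u \- c)) - dist2 u c.
  by move=> v2; rewrite (pairingBl v2 c2 g2).
have lim : 2 * (pairing (u_ k) (u \- c) - pairing c (u \- c)) - dist2 u c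
    @[k --> \oo] --> 2 * (pairing u (u \- c) - pairing c (u \- c)) - dist2 u c.
  apply: cvgB; last exact: cvg_cst.
  by apply: cvgMr; apply: cvgB; [exact: uu|exact: cvg_cst].
have Du : 2 * (pairing u (u \- c) - pairing c (u \- c)) - dist2 u c = dist2 u c.
  by rewrite -(pairingBl u2 c2 g2); lra.
rewrite Du in lim; rewrite /tangent; under eq_fun do rewrite E ?Lspace2_Lfun//.
exact: lim.
Qed.

(** Direct method. Along a minimizing sequence u_k converging weakly to u, Rg u_k is
    at most the value of the functional at u_k minus the tangent minorant of
    the fidelity term, and this difference converges. *)
Lemma argmin_fidelity (eta : L2) (Rg : L2 -> \bar R) :
  (forall v, 0 <= Rg v)%E -> weak_lsc Rg -> (exists v, Rg v < +oo)%E ->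
  argmin (fun u => L2dist2 u eta + Rg u)%E !=set0.
Proof.
move=> R0 Rlsc [v0 v0y].
pose J u := (L2dist2 u eta + Rg u)%E.
have J0 u : (0 <= J u)%E by rewrite adde_ge0 ?L2dist2_ge0.
pose m := ereal_inf (range J).
have mJ u : (m <= J u)%E by apply: ereal_inf_lbound; exists u.
have m0 : (0 <= m)%E by apply: le_ereal_inf_tmp => _ [u _ <-].
have my : (m < +oo)%E.
  by apply: le_lt_trans (mJ v0) _; rewrite /J L2dist2E lte_add_pinfty// ltry.
have mE : m = (fine m)%:E by rewrite fineK// ge0_fin_numE.
have u_ex k : exists u, (J u < (fine m + k.+1%:R^-1)%:E)%E.
  have /ereal_inf_lt[_ [u _ <-] uJ] : (m < (fine m + k.+1%:R^-1)%:E)%E.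
    by rewrite {1}mE lte_fin ltrDl invr_gt0.
  by exists u.
have [u_ uJ] := choice u_ex.
have [] := @L2_weak_compact unit (fun _ => u_)
    (2 * (fine m + 1) + 2 * pairing eta eta).
  move=> _ k; have : dist2 (u_ k) eta <= fine m + 1.
    rewrite -lee_fin -L2dist2E; apply: (@le_trans _ _ (J (u_ k))).
      by rewrite /J leeDl.
    apply: le_trans (ltW (uJ k)) _; rewrite lee_fin lerD2l invf_le1//.
    by rewrite ler1n.
  by move=> h; apply: le_trans (pairing_le_dist _ eta) _; lra.
move=> s si /(_ tt)[u /= uu].
have Ru : (Rg u <= (fine m - dist2 u eta)%:E)%E.
  apply: le_trans (Rlsc _ _ uu) _; apply: le_trans (limn_einf_sup _) _.
  apply: (@limn_esup_le_cvg_near _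
    (fun k => (fine m + k.+1%:R^-1 - tangent eta u (u_ (s k)))%:E)).
    apply: nearW => k /=.
    have : (J (u_ (s k)) <= (fine m + k.+1%:R^-1)%:E)%E.
      apply: le_trans (ltW (uJ (s k))) _; rewrite lee_fin lerD2l.
      rewrite lef_pV2 ?posrE// ler_nat ltnS; exact: increasing_seq_ge.
    rewrite /J L2dist2E -leeBrDl// -EFinB => /le_trans; apply.
    by rewrite lee_fin lerB// tangent_le.
  apply: cvg_EFin; first exact: nearW.
  rewrite -[X in _ --> X - _](addr0 (fine m)).
  apply: cvgB; last exact: tangent_cvg uu.
  by apply: cvgD; [exact: cvg_cst|exact: cvg_harmonic].
exists u => v; apply: le_trans (mJ v).
by rewrite L2dist2E mE -leeBrDl// -EFinB.
Qed.

(** Compare w_k with a recovery sequence of an arbitrary competitor. *)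
Lemma Gamma_lim_argmin (F_ : nat -> L2 -> \bar R) (F : L2 -> \bar R)
    (w_ : nat -> L2) (w : L2) :
  Gamma_lim F_ F -> (forall k, argmin (F_ k) (w_ k)) -> weak_cvg w_ w -> argmin F w.
Proof.
move=> [Finf Fsup] wmin ww v; have [v_ vv vF] := Fsup v.
apply: le_trans (Finf _ _ ww) (le_trans _ vF).
apply: le_trans (limn_einf_sup _).
rewrite !limn_einf_lim; apply: lee_lim; [exact: is_cvg_einfs|exact: is_cvg_einfs|].
apply: nearW => k; apply: le_ereal_inf_tmp => _ [m /= km <-].
apply: le_trans (wmin m (v_ m)); by apply: ereal_inf_lbound; exists m.
Qed.

Lemma L2Ndist2E N (w v : 'I_N -> L2) :
  L2Ndist2 w v = (\sum_(j < N) dist2 (w j) (v j))%:E.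
Proof. by rewrite /L2Ndist2 -sumEFin; apply: eq_bigr => j _; rewrite L2dist2E. Qed.

Section Bilevel.
Context (X : Type) (N : nat) (Lam : set X) (uc ueta : 'I_N -> L2)
  (Reg : X -> L2 -> \bar R).
Hypothesis Lam0 : Lam !=set0.
Hypothesis Reg_ge0 : forall lam, Lam lam -> forall v, (0 <= Reg lam v)%E.
Hypothesis Reg_lsc : forall lam, Lam lam -> weak_lsc (Reg lam).
Hypothesis Reg_dom : forall lam, Lam lam -> exists v, (Reg lam v < +oo)%E.
Hypothesis stable : weakly_stable Lam (denoising ueta Reg).
Local Notation J := (denoising ueta Reg).

Lemma reconstructions_neq0 lam : Lam lam -> reconstructions J lam !=set0.
Proof.
move=> Ll.
have h j : exists u, argmin (J lam j) u.
  exact: argmin_fidelity (Reg_ge0 Ll) (Reg_lsc Ll) (Reg_dom Ll).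
by have [w wP] := choice h; exists w.
Qed.

Lemma upper_level_ge0 lam : (0 <= upper_level uc J lam)%E.
Proof.
apply: le_ereal_inf_tmp => _ [w _ <-]; rewrite L2Ndist2E lee_fin.
by apply: sumr_ge0 => j _; exact: pairing_ge0.
Qed.

Lemma upper_level_lty lam : Lam lam -> (upper_level uc J lam < +oo)%E.
Proof.
move=> /reconstructions_neq0[w wK]; apply: (@le_lt_trans _ _ (L2Ndist2 w uc)).
  by apply: ereal_inf_lbound; exists w.
by rewrite L2Ndist2E ltry.
Qed.

(** Two successive extractions are needed: the first for the weak convergence of
    the reconstructions w_k, the second for the Gamma-convergence of all
    lower-level functionals along it. *)
Lemma upper_level_minimizer : exists2 lam0, Lam lam0 &
  forall lam, Lam lam -> (upper_level uc J lam0 <= upper_level uc J lam)%E.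
Proof.
pose m := ereal_inf [set upper_level uc J lam | lam in Lam].
have mU lam : Lam lam -> (m <= upper_level uc J lam)%E.
  by move=> Ll; apply: ereal_inf_lbound; exists lam.
have m0 : (0 <= m)%E by apply: le_ereal_inf_tmp => _ [lam _ <-]; exact: upper_level_ge0.
have my : (m < +oo)%E.
  by case: Lam0 => lam Ll; apply: le_lt_trans (mU _ Ll) (upper_level_lty Ll).
have mE : m = (fine m)%:E by rewrite fineK// ge0_fin_numE.
have ex k : exists p : X * ('I_N -> L2), [/\ Lam p.1, reconstructions J p.1 p.2 &
    \sum_(j < N) dist2 (p.2 j) (uc j) < fine m + k.+1%:R^-1].
  have /ereal_inf_lt[_ [lam Ll <-]] : (m < (fine m + k.+1%:R^-1)%:E)%E.
    by rewrite {1}mE lte_fin ltrDl invr_gt0.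
  move=> /ereal_inf_lt[_ [w wK <-]]; rewrite L2Ndist2E lte_fin => wm.
  by exists (lam, w).
have [p_ pP] := choice ex.
pose lam_ k := (p_ k).1; pose w_ k := (p_ k).2.
have [] := @L2_weak_compact 'I_N (fun j k => w_ k j)
    (2 * (fine m + 1) + 2 * \sum_(j < N) pairing (uc j) (uc j)).
  move=> j k; apply: le_trans (pairing_le_dist _ (uc j)) _.
  apply: lerD; rewrite ler_pM2l//.
    have [_ _ wm] := pP k.
    apply: (@le_trans _ _ (\sum_(j < N) dist2 (w_ k j) (uc j))).
      by rewrite (bigD1 j)//= lerDl; apply: sumr_ge0 => i _; exact: pairing_ge0.
    by apply: le_trans (ltW wm) _; rewrite lerD2l invf_le1// ler1n.
  by rewrite (bigD1 j)//= lerDl; apply: sumr_ge0 => i _; exact: pairing_ge0.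
move=> s1 s1i /choice[w ww].
have [] := @Gamma_compact 'I_N
    (fun k j => J (lam_ (s1 k)) j) ueta.
  by move=> k j u; rewrite /denoising leeDl// Reg_ge0//; case: (pP (s1 k)).
move=> s2 s2i Gc.
pose s := s1 \o s2.
have si : increasing_seq s by exact: increasing_seq_comp.
have [|lam0 L0 Glim] := stable (lam_ := lam_ \o s) _ Gc.
  by move=> k; case: (pP (s k)).
have wwj j : weak_cvg (fun k => w_ (s k) j) (w j).
  move=> g; have := ww j g; apply: cvg_comp; exact: (increasing_seq_cvg s2i).
have wK : reconstructions J lam0 w.
  move=> j; apply: (Gamma_lim_argmin (Glim j) _ (wwj j)) => k.
  by have [_ wK _] := pP (s k); exact: wK.
exists lam0 => // lam Ll; apply: le_trans (mU _ Ll).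
apply: (@le_trans _ _ (L2Ndist2 w uc)); first by apply: ereal_inf_lbound; exists w.
rewrite L2Ndist2E mE lee_fin.
have tc : \sum_(j < N) tangent (uc j) (w j) (w_ (s k) j) @[k --> \oo] -->
    \sum_(j < N) dist2 (w j) (uc j).
  by apply: cvg_big => [|j _]; [exact: add_continuous|exact: tangent_cvg (wwj j)].
have hc : fine m + k.+1%:R^-1 @[k --> \oo] --> fine m.
  rewrite -[X in _ --> X](addr0 (fine m)).
  by apply: cvgD; [exact: cvg_cst|exact: cvg_harmonic].
rewrite -(cvg_lim (@Rhausdorff R) tc) -(cvg_lim (@Rhausdorff R) hc).
apply: ler_lim; [by apply/cvg_ex; eexists; exact: tc|by apply/cvg_ex; eexists; exact: hc|].
apply: nearW => k; have [_ _ wm] := pP (s k).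
apply: le_trans (le_trans (ltW wm) _).
  by apply: ler_sum => j _; exact: tangent_le.
by rewrite lerD2l lef_pV2 ?posrE// ler_nat ltnS; exact: increasing_seq_ge.
Qed.

End Bilevel.
End CountablyGenerated.

(** * The measure space of a bounded open set *)

(** Finite intersections of generators, indexed by the finite sequences of
    indices; the empty intersection is the whole space. *)
Lemma countable_pi_system d (T : measurableType d) (K : countType) (B : K -> set T) :
  (forall p, measurable (B p)) -> measurable `<=` <<s range B >> ->
  exists A : nat -> set T, [/\ forall i, measurable (A i),
    forall i j, exists k, A i `&` A j = A k, exists k, A k = setT &
    measurable `<=` <<s range A >>].
Proof.
move=> mB Bgen.
pose S (i : nat) : seq K := odflt [::] (unpickle i).
pose A i := \big[setI/setT]_(p <- S i) B p.
have SK r : S (pickle r) = r by rewrite /S pickleK.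
exists A; split.
- by move=> i; rewrite /A; elim/big_ind: _ => //; exact: measurableI.
- by move=> i j; exists (pickle (S i ++ S j)); rewrite /A SK big_cat.
- by exists (pickle ([::] : seq K)); rewrite /A SK big_nil.
- apply: subset_trans Bgen _; apply: smallest_sub.
    exact: smallest_sigma_algebra.
  move=> _ [p _ <-]; apply: sub_sigma_algebra; exists (pickle [:: p]) => //.
  by rewrite /A SK big_seq1.
Qed.

Section Omega.
Context {R : realType} {n : nat}.

Definition rational_ball (p : 'rV[rat]_n * nat) : set 'rV[R]_n :=
  ball (map_mx ratr p.1 : 'rV[R]_n) p.2.+1%:R^-1.

Lemma rational_ball_open p : open (rational_ball p).
Proof. exact: ball_open. Qed.

(** The radius 1/(k+1) is taken below half the distance from t to the complement
    of U, so that a ball of this radius around a rational point close to t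
    contains t and remains inside U. *)
Lemma open_bigcup_rational_ball (U : set 'rV[R]_n) : open U ->
  U = \bigcup_(p in [set p | rational_ball p `<=` U]) rational_ball p.
Proof.
move=> oU; apply/seteqP; split => [t Ut|t [p pU]]; last exact: pU.
have /nbhs_ballP[e /= e0 eU] : nbhs t U by exact: open_nbhs_nbhs.
have e2 : 0 < e / 2 by rewrite divr_gt0.
have [k _ /(_ k (leqnn k)) ke] := near_infty_natSinv_lt (PosNum e2).
have r0 : (0 : R) < k.+1%:R^-1 by rewrite invr_gt0.
have q_ i : exists q : rat, `|ratr q - t ord0 i| < k.+1%:R^-1.
  have /rat_in_itvoo[q] : t ord0 i - k.+1%:R^-1 < t ord0 i + k.+1%:R^-1.
    by rewrite ltrD2l (lt_trans _ r0)// oppr_lt0.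
  by rewrite in_itv /= => hq; exists q; rewrite distrC ltr_distlC.
have [q qP] := choice q_.
have qt : rational_ball (\row_i q i, k) t.
  by split => // i j; rewrite !mxE (ord1 i); exact: qP.
exists (\row_i q i, k) => //= y qy; apply: eU.
apply: (@le_ball _ _ _ (k.+1%:R^-1 + k.+1%:R^-1)).
  by rewrite [leRHS]splitr lerD ?ltW.
by apply: ball_triangle qy; apply: ball_sym.
Qed.

Lemma measurable_rational_ball : @measurable _ (borelRn n) `<=`
  <<s range (rational_ball : _ -> set (@borelRn R n)) >>.
Proof.
apply: smallest_sub; first exact: smallest_sigma_algebra.
move=> U /open_bigcup_rational_ball ->.
pose K := ('rV[rat]_n * nat)%type.
have -> : \bigcup_(p in [set p | rational_ball p `<=` U]) rational_ball p =
  \bigcup_i (if @unpickle K i is Some p then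
    if `[< rational_ball p `<=` U >] then rational_ball p else set0 else set0).
  apply/seteqP; split => [t [p pU pt]|t [i _]].
    by exists (pickle p) => //; rewrite pickleK; case: asboolP.
  by case: unpickle => // p; case: asboolP => // pU pt; exists p.
have [s0 _ sU] := smallest_sigma_algebra setT
  (range (rational_ball : _ -> set (@borelRn R n))).
apply: sU => i; case: unpickle => // p; case: asboolP => // _.
by apply: sub_sigma_algebra; exists p.
Qed.

Lemma lebesgue_on_finite (Omega : set 'rV[R]_n) (oO : open Omega) :
  bounded_set Omega -> (lebesgue_on oO setT < +oo)%E.
Proof.
move=> [M [Mr HM]].
pose r := `|M| + 1.
have Mlt : M < r by rewrite (le_lt_trans (ler_norm M))// ltrDl.
pose box := [set x : 'rV[R]_n | forall i, - r <= x ord0 i <= r].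
have r0 : 0 <= r by rewrite addr_ge0.
have Ob : Omega `<=` box.
  move=> x Ox i; rewrite -ler_norml; apply: le_trans (HM r Mlt x Ox).
  rewrite /Num.norm /= mx_normrE.
  exact: (le_bigmax _ _ (ord0, i)).
have -> : lebesgue_on oO setT = lebesgueRn n Omega by rewrite /= /mrestr setTI.
apply: (@le_lt_trans _ _ (lebesgueRn n box)); last first.
  by rewrite lebesgueRn_box ?ltry// => i; lra.
apply: le_measure => //; rewrite inE; first exact: open_measurable_Rn.
rewrite (_ : box = \bigcap_(i in [set: 'I_n])
  ((fun x : borelRn n => (x : 'rV[R]_n) ord0 i) @^-1` `[- r, r]%classic)); last first.
  by apply/seteqP; split => x /= h i => [_|]; have := h i; rewrite /= in_itv//=; apply.
apply: fin_bigcap_measurable => // i _.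
by rewrite -[X in measurable X]setTI; exact: measurable_coord_Rn.
Qed.

End Omega.

Theorem theorem2p3 (R : realType) (n N : nat)
    (Omega : set 'rV[R]_n) (oO : open Omega) (bO : bounded_set Omega)
    (uc ueta : 'I_N -> LspaceType2 (lebesgue_on oO))
    (X : topologicalType) (fcX : first_countable X)
    (Lam : set X) (Lam0 : Lam !=set0)
    (Reg : X -> LspaceType2 (lebesgue_on oO) -> \bar R)
    (Reg_ge0 : forall lam, Lam lam -> forall v, (0 <= Reg lam v)%E)
    (Reg_lsc : forall lam, Lam lam -> weak_lsc (Reg lam))
    (Reg_dom : forall lam, Lam lam -> exists v, (Reg lam v < +oo)%E)
    (stable : weakly_stable Lam (denoising ueta Reg)) :
  (forall lam, Lam lam -> (0 <= upper_level uc (denoising ueta Reg) lam < +oo)%E) /\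
  (exists2 lam0, Lam lam0 &
     forall lam, Lam lam ->
       (upper_level uc (denoising ueta Reg) lam0
          <= upper_level uc (denoising ueta Reg) lam)%E).
Proof.
have fin := lebesgue_on_finite oO bO.
have mB p : @measurable _ (borelRn n) (rational_ball p : set (@borelRn R n)).
  by apply: open_measurable_Rn; exact: rational_ball_open.
have [A [mA AI AT Agen]] := countable_pi_system mB (@measurable_rational_ball R n).
split.
  move=> lam Ll; rewrite upper_level_ge0 /=.
  exact: (upper_level_lty fin mA AI AT Agen uc ueta Reg_ge0 Reg_lsc Reg_dom Ll).
exact: (upper_level_minimizer fin mA AI AT Agen uc Lam0 Reg_ge0 Reg_lsc Reg_dom stable).
Qed.
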